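(* Let $H$ be a connected graph and $G=L(H)$. Then $G$ is localizable if and only if one of the following holds: (1) $H$ is not isomorphic to any of $K_3$, $K_4$, the diamond, and the pendant reduction $F$ of $H$ is a connected bipartite graph with a bipartition of $V(F)$ into independent sets $U$ and $W$ such that (a) $R_{\diamond}(H)\cup R_{K_4}(H)\subseteq U$, (b) $R_{\triangle}(H)\subseteq W$, and (c) every vertex $u\in U\setminus R_{K_4}(H)$ is strong in the graph $F-(N_F(u)\cap R_{\triangle}(H))$; (2) $H$ is isomorphic to $K_3$ or to $K_4$.
   Context: $L(H)$ is the line graph of $H$. A clique is strong if it intersects every maximal independent set; a graph is localizable if its vertex set admits a partition into strong cliques. A vertex $v$ of a graph is strong if every maximal matching of that graph covers $v$. The diamond is the graph with vertices $a,b,c,d$ and edges $ab,ac,bc,bd,cd$, with tips $a,d$. Let $d_H$ denote degree in $H$. For a triangle with vertices $a,b,c$ in $H$: it is a pendant triangle if $d_H(a)=d_H(b)=2<d_H(c)$, with root $c$; a pendant diamond is a set of vertices $a,b,c,d$ of $H$ inducing a diamond with tips $a,d$ such that $d_H(a)=2$ and $d_H(b)=d_H(c)=3\le d_H(d)$, with root $d$; a pendant $K_4$ is a set of vertices $a,b,c,d$ inducing $K_4$ with $d_H(a)=d_H(b)=d_H(c)=3<d_H(d)$, with root $d$. These are the pendant subgraphs of $H$. $R_{\triangle}(H)$, $R_{\diamond}(H)$, $R_{K_4}(H)$ denote the sets of roots of all pendant triangles, pendant diamonds, and pendant $K_4$s of $H$, respectively. The pendant reduction of $H$ is the graph obtained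 from $H$ by deleting all non-root vertices of all its pendant subgraphs. $N_F(u)$ is the neighborhood of $u$ in $F$. *)

(* Defs.v *)
(* Simple graphs are symmetric irreflexive relations on a finType. *)
From mathcomp Require Import all_boot.
Set Implicit Arguments. Unset Strict Implicit. Unset Printing Implicit Defensive.

Section GenericGraph.
Variables (T : finType) (g : rel T).

Definition independent (S : {set T}) : bool :=
  [forall x in S, forall y in S, ~~ g x y].

Definition maximal_independent (S : {set T}) : Prop :=
  independent S /\ forall S' : {set T}, independent S' -> S \subset S' -> S' = S.

Definition clique (C : {set T}) : bool :=
  [forall x in C, forall y in C, (x != y) ==> g x y].

Definition strong_clique (C : {set T}) : Prop :=
  clique C /\ forall I : {set T}, maximal_independent I -> C :&: I != set0.

Definition localizable : Prop :=
  exists P : {set {set T}}, partition P [set: T] /\ forall C, C \in P -> strong_clique C.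

Definition isomorphic (T' : finType) (g' : rel T') : Prop :=
  exists f : T -> T', bijective f /\ forall x y, g x y = g' (f x) (f y).

End GenericGraph.

Definition K3 : rel 'I_3 := fun x y => x != y.
Definition K4 : rel 'I_4 := fun x y => x != y.
Definition diamond : rel 'I_4 := fun x y =>
  (x != y) && ~~ (((val x == 0) && (val y == 3)) || ((val x == 3) && (val y == 0))).

Section OnH.
Variables (V : finType) (h : rel V).

Definition deg (x : V) : nat := #|[set y | h x y]|.

Definition induced (S : {set V}) : rel V :=
  fun x y => [&& h x y, x \in S & y \in S].
Definition connected_on (S : {set V}) : Prop :=
  S != set0 /\ forall x y, x \in S -> y \in S -> connect (induced S) x y.

Definition is_edge (e : {set V}) : bool :=
  [exists x, exists y, h x y && (e == [set x; y])].
Definition Edge := {e : {set V} | is_edge e}.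

Definition line_graph : rel Edge :=
  fun e f => (e != f) && (val e :&: val f != set0).

Definition matching_in (S : {set V}) (M : {set Edge}) : bool :=
  [forall e in M, val e \subset S] &&
  [forall e in M, forall f in M, (e != f) ==> (val e :&: val f == set0)].
Definition maximal_matching_in (S : {set V}) (M : {set Edge}) : Prop :=
  matching_in S M /\
  forall M' : {set Edge}, matching_in S M' -> M \subset M' -> M' = M.
Definition strong_vertex_in (S : {set V}) (v : V) : Prop :=
  forall M, maximal_matching_in S M -> exists2 e, e \in M & v \in val e.

Definition ptri (a b c : V) : bool :=
  [&& h a b, h b c, h a c, deg a == 2, deg b == 2 & 2 < deg c].
Definition pdiam (a b c d : V) : bool :=
  [&& h a b, h a c, h b c, h b d, h c d, ~~ h a d, a != d,
      deg a == 2, deg b == 3, deg c == 3 & 3 <= deg d].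
Definition pK4 (a b c d : V) : bool :=
  [&& h a b, h a c, h a d, h b c, h b d, h c d,
      deg a == 3, deg b == 3, deg c == 3 & 3 < deg d].

Definition R_tri : {set V} := [set c | [exists a, exists b, ptri a b c]].
Definition R_diam : {set V} :=
  [set d | [exists a, exists b, exists c, pdiam a b c d]].
Definition R_K4 : {set V} :=
  [set d | [exists a, exists b, exists c, pK4 a b c d]].

Definition nonroots : {set V} := [set x |
  [exists b, exists c, ptri x b c] || [exists a, exists c, ptri a x c] ||
  [exists b, exists c, exists d, pdiam x b c d] ||
  [exists a, exists c, exists d, pdiam a x c d] ||
  [exists a, exists b, exists d, pdiam a b x d] ||
  [exists b, exists c, exists d, pK4 x b c d] ||
  [exists a, exists c, exists d, pK4 a x c d] ||
  [exists a, exists b, exists d, pK4 a b x d]].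

Definition pendant_reduction : {set V} := ~: nonroots.

Definition bipartition (S U W : {set V}) : bool :=
  [&& U :|: W == S, U :&: W == set0, independent h U & independent h W].

Definition nbhd_in (S : {set V}) (u : V) : {set V} := [set y in S | h u y].

End OnH.

Arguments line_graph {V} h.

(* Main.v *)
Require Import Defs.
From mathcomp Require Import all_boot.
Set Implicit Arguments. Unset Strict Implicit. Unset Printing Implicit Defensive.

(* A clique of the line graph lies in a star or a triangle of H.  A star at v is strong
   iff no matching missing v covers the neighbourhood of v, and a triangle is strong iff
   no two disjoint edges leave it from distinct vertices; in a connected H other than
   K3, K4 and the diamond, the latter singles out the triangles that contain the non-root
   vertices of a pendant subgraph.  Hence a partition of L(H) into strong cliques
   consists of these triangles, which are all forced because non-root vertices are never
   strong, and of the stars at the vertices of one side U of a bipartition of the pendant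
   reduction.  The parity of the three non-root vertices makes the root of a pendant K4
   strong; for the other vertices u of U, strength in H amounts to strength in the
   reduction once the neighbouring triangle roots, which can always be matched into their
   triangles, are deleted. *)

(** Strength speaks of all maximal matchings, and a maximal matching of [h] need not restrict to a
    maximal one of the reduction. Only the partners of the neighbours of the vertex matter, so
    strength is recast as the absence of an [escape], a function on these neighbours that can be
    carried between the two graphs. The roots fall on different sides of the bipartition because the
    triangle forced by a pendant triangle contains its root, which therefore is not the centre of a
    star, whereas those forced by a pendant diamond or [K_4] leave out the root, and the edges from
    them to the root must be covered by its star. The diamond itself needs a separate argument: both
    of its triangles give strong cliques, but they share an edge. *)

Section GraphFacts.
Variables (T : finType) (g : rel T).

(** * Independent sets, cliques and isomorphisms of a general graph *)

Lemma independentP (S : {set T}) :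
  reflect (forall x y, x \in S -> y \in S -> ~~ g x y) (independent g S).
Proof.
apply: (iffP forall_inP) => [H x y xS yS|H x xS]; first exact: (forall_inP (H x xS)).
by apply/forall_inP => y; apply: H.
Qed.

Lemma cliqueP (S : {set T}) :
  reflect (forall x y, x \in S -> y \in S -> x != y -> g x y) (clique g S).
Proof.
apply: (iffP forall_inP) => [H x y xS yS|H x xS].
  exact: (implyP (forall_inP (H x xS) y yS)).
by apply/forall_inP => y yS; apply/implyP; apply: H.
Qed.

Lemma maximal_independent_extend (S : {set T}) :
  independent g S -> exists2 I, maximal_independent g I & S \subset I.
Proof.
move=> /maxset_exists [I /maxsetP [indI maxI] sSI]; exists I => //.
Qed.

(** A vertex [k] of [D] outside [C] extends to a maximal independent set, which would meet [C] in a
    vertex adjacent to [k]. *)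
Lemma strong_clique_maximal (C D : {set T}) :
  irreflexive g -> strong_clique g C -> clique g D -> C \subset D -> C = D.
Proof.
move=> girr [_ strC] /cliqueP clD sCD; apply/eqP; rewrite eqEsubset sCD /=.
apply/subsetP => k kD; apply/negPn/negP => kC.
have ind_k : independent g [set k].
  by apply/independentP => x y /set1P -> /set1P ->; rewrite girr.
have [I maxI] := maximal_independent_extend ind_k; rewrite sub1set => kI.
have /set0Pn [f /setIP [fC fI]] := strC I maxI.
have /independentP indI := maxI.1.
case/negP: (indI f k fI kI); apply: clD => //; first exact: (subsetP sCD).
by apply: contraNneq kC => <-.
Qed.

(** Allows a constructive case split on [K3] and [K4]: the search runs over finite functions, with
    injectivity and a cardinality bound in place of a two-sided inverse. *)
Lemma isomorphic_decidable (T' : finType) (g' : rel T') : decidable (isomorphic g g').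
Proof.
pose iso (f : {ffun T -> T'}) :=
  [&& injectiveb f, #|T'| <= #|T| & [forall x, forall y, g x y == g' (f x) (f y)]].
case: (boolP [exists f, iso f]) => [iso_f|no_iso]; [left|right].
  have /existsP [f /and3P [/injectiveP injf cardT /forallP fE]] := iso_f.
  exists f; split=> [|x y]; first exact: inj_card_bij.
  exact/eqP/(forallP (fE x)).
case=> f [bijf fE]; case/existsP: no_iso; exists (finfun f); apply/and3P; split.
- by apply/injectiveP => x y; rewrite !ffunE; apply: bij_inj.
- by rewrite (bij_eq_card bijf).
- by apply/forallP => x; apply/forallP => y; rewrite !ffunE fE.
Qed.

End GraphFacts.

Section Matchings.
Variables (V : finType) (h : rel V).
Hypotheses (hsym : symmetric h) (hirr : irreflexive h).

Implicit Types (e f : Edge h) (M : {set Edge h}) (S T U : {set V}).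

(** * Edges, matchings and strong vertices *)

Lemma adj_neq {x y} : h x y -> x != y.
Proof. by apply: contraTneq => ->; rewrite hirr. Qed.

Lemma edgeP e : exists x y, h x y /\ val e = [set x; y].
Proof. by case/existsP: (valP e) => x /existsP [y /andP [hxy /eqP]]; exists x, y. Qed.

Lemma edge_of {x y} : h x y -> exists e, val e = [set x; y].
Proof.
move=> hxy; suff e_xy : is_edge h [set x; y] by exists (Sub _ e_xy).
by apply/existsP; exists x; apply/existsP; exists y; rewrite hxy eqxx.
Qed.

Lemma edge_at e x : x \in val e -> exists2 y, h x y & val e = [set x; y].
Proof.
have [a [b [hab eE]]] := edgeP e; rewrite eE => /set2P [->|->]; first by exists b.
by exists a; [rewrite hsym | rewrite setUC].
Qed.

Lemma edge_pair e x y : val e = [set x; y] -> h x y.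
Proof.
move=> eE; have [z hxz] : exists2 z, h x z & val e = [set x; z].
  by apply: edge_at; rewrite eE set21.
move=> ezE; have: z \in [set x; y] by rewrite -eE ezE set22.
by case/set2P => [zx|<- //]; rewrite zx hirr in hxz.
Qed.

Lemma edge_of_two e x y : x \in val e -> y \in val e -> x != y -> val e = [set x; y].
Proof.
move=> /edge_at [z _ ->] /set2P [-> /eqP //|-> //].
Qed.

Lemma matchingP S M :
  reflect ((forall e, e \in M -> val e \subset S) /\
           (forall e f z, e \in M -> f \in M -> z \in val e -> z \in val f -> e = f))
          (matching_in S M).
Proof.
apply: (iffP andP) => [[/forall_inP sub /forall_inP dis]|[sub dis]]; split=> //.
- move=> e f z eM fM ze zf; apply/eqP; apply: contraT => ef.
  have /eqP ef0 := implyP (forall_inP (dis e eM) f fM) ef.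
  by have := in_set0 z; rewrite -ef0 inE ze zf.
- by apply/forall_inP.
- apply/forall_inP => e eM; apply/forall_inP => f fM; apply/implyP; apply: contraNT.
  by case/set0Pn => z /setIP [ze zf]; apply/eqP; apply: dis ze zf.
Qed.

Lemma maximal_matching_extend S M :
  matching_in S M -> exists2 M', maximal_matching_in S M' & M \subset M'.
Proof.
move=> /maxset_exists [I /maxsetP [mI maxI] sMI]; exists I => //.
Qed.

(* A maximal matching that misses a neighbour [w] of a missed vertex [v] could be
   enlarged by the edge [vw]. *)
Lemma maximal_matching_covers S M v w : maximal_matching_in S M -> v \in S -> w \in S ->
  h v w -> ~~ [exists e in M, v \in val e] -> exists2 e, e \in M & w \in val e.
Proof.
move=> [/matchingP [sub dis] maxM] vS wS hvw vM.
apply/exists_inP; apply: contraT => wM; have [k kE] := edge_of hvw.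
have kM : k \in M.
  rewrite -(maxM (k |: M)) ?setU11 ?subsetUr //; apply/matchingP; split=> [e|e f z].
    by case/setU1P => [->|/sub //]; rewrite kE subUset !sub1set vS wS.
  have nk i : i \in M -> z \in val i -> z \notin val k.
    move=> iM zi; rewrite kE; apply/negP => /set2P zE.
    case: zE => zE; [case/negP: vM|case/negP: wM];
    by apply/exists_inP; exists i; rewrite // -zE.
  case/setU1P => [->|eM] /setU1P [->|fM] // ze zf; last exact: dis ze zf.
    by rewrite (negPf (nk f fM zf)) in ze.
  by rewrite (negPf (nk e eM ze)) in zf.
by case/negP: vM; apply/exists_inP; exists k; rewrite // kE set21.
Qed.

(* The edges [w, m w], for [w] a neighbour of [v] in [S], form a matching that
   covers these neighbours and misses [v]. *)
Definition escape S v (m : V -> V) : Prop :=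
  (forall w, w \in S -> h v w -> [/\ m w \in S, m w != v & h w (m w)]) /\
  (forall w w', w \in S -> h v w -> w' \in S -> h v w' ->
     (m w = m w' -> w = w') /\ (m w = w' -> m w' = w)).

(** The matching given by [m] extends to a maximal one, which would cover [v] by some edge [vw]; but
    [w] is already matched to [m w], which is not [v]. *)
Lemma strong_no_escape S v m : strong_vertex_in h S v -> ~ escape S v m.
Proof.
move=> strv [mP mI].
pose M := [set e : Edge h | [exists w, [&& w \in S, h v w & val e == [set w; m w]]]].
have ME e : e \in M -> exists w, [/\ w \in S, h v w & val e = [set w; m w]].
  by rewrite inE => /existsP [w /and3P [wS hvw /eqP eE]]; exists w.
have matM : matching_in S M.
  apply/matchingP; split=> [e /ME [w [wS hvw ->]]|e f z].
    by rewrite subUset !sub1set wS; have [] := mP w wS hvw.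
  move=> /ME [w [wS hvw eE]] /ME [w' [wS' hvw' fE]] ze zf; apply: val_inj.
  have [inj inv] := mI w w' wS hvw wS' hvw'.
  have [_ inv'] := mI w' w wS' hvw' wS hvw.
  rewrite /= eE fE; move: ze zf; rewrite eE fE => /set2P [] -> /set2P [] => [->||| /inj ->] //.
    by move=> E; rewrite {1}E (inv' (esym E)) -E setUC.
  by move=> E; rewrite (inv E) E setUC.
have [M' maxM' /subsetP sMM'] := maximal_matching_extend matM.
have [e eM' ve] := strv M' maxM'.
have /matchingP [subM' disM'] := maxM'.1.
have [w hvw eE] := edge_at ve.
have wS : w \in S by apply: (subsetP (subM' e eM')); rewrite eE set22.
have [_ mv hwm] := mP w wS hvw; have [f fE] := edge_of hwm.
have fM : f \in M by rewrite inE; apply/existsP; exists w; rewrite wS hvw fE eqxx.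
have ef : e = f by apply: (disM' e f w); rewrite ?eE ?fE ?set21 ?set22 // sMM'.
have: v \in val f by rewrite -ef.
by rewrite fE !inE (negPf (adj_neq hvw)) eq_sym (negPf mv).
Qed.

(** A maximal matching missing [v] covers every neighbour of [v], so sending each neighbour to its
    partner is an escape. *)
Lemma no_escape_strong S v :
  v \in S -> (forall m, ~ escape S v m) -> strong_vertex_in h S v.
Proof.
move=> vS noesc M maxM; apply/exists_inP; apply: contraT => vM; exfalso.
pose Q w y := [exists e in M, val e == [set w; y]].
(* The default [w] is never returned for a neighbour of [v] in [S]: [mQ] shows that a partner
   exists. *)
apply: (noesc (fun w => odflt w [pick y | Q w y])).
have mQ w : w \in S -> h v w -> Q w (odflt w [pick y | Q w y]).
  move=> wS hvw; case: pickP => //= noQ.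
  have [e eM we] := maximal_matching_covers maxM vS wS hvw vM.
  have [y _ eE] := edge_at we.
  by case/exists_inP: (noQ y); exists e; rewrite ?eE.
have /matchingP [sub dis] := maxM.1.
split=> [w wS hvw|w w' wS hvw wS' hvw'].
  have /exists_inP [e eM /eqP eE] := mQ w wS hvw; set y := odflt _ _ in eE *.
  split; last exact: edge_pair eE.
    by apply: (subsetP (sub e eM)); rewrite eE set22.
  apply: contraNneq vM => yv; apply/exists_inP; exists e => //.
  by rewrite eE -yv set22.
have /exists_inP [e eM /eqP eE] := mQ w wS hvw; set y := odflt w _ in eE *.
have /exists_inP [f fM /eqP fE] := mQ w' wS' hvw'; set y' := odflt w' _ in fE *.
split=> E.
  have ef : e = f by apply: (dis e f y); rewrite ?eE ?fE ?E ?set22.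
  have: w \in val f by rewrite -ef eE set21.
  rewrite fE => /set2P [//|wy']; have := adj_neq (edge_pair eE).
  by rewrite E wy' eqxx.
have ef : e = f by apply: (dis e f w'); rewrite ?eE ?fE ?E ?set21 ?set22.
have: y' \in val e by rewrite ef fE set22.
rewrite eE => /set2P [//|y'y]; have := adj_neq (edge_pair fE).
by rewrite y'y E eqxx.
Qed.

(** * Stars and triangles as strong cliques of the line graph *)

Definition star v : {set Edge h} := [set e : Edge h | v \in val e].
Definition edges_in T : {set Edge h} := [set e : Edge h | val e \subset T].

Definition triangle T := (#|T| == 3) && clique h T.

Lemma maximal_matching_independent M :
  maximal_matching_in [set: V] M <-> maximal_independent (line_graph h) M.
Proof.
have matE I : matching_in [set: V] I = independent (line_graph h) I.
  apply/matchingP/independentP => [[_ dis] e f eI fI|ind].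
    apply/andP => -[/eqP ef /set0Pn [z /setIP [ze zf]]]; exact/ef/(dis e f z).
  split=> [e _|e f z eI fI ze zf]; first exact: subsetT.
  apply/eqP; apply: contraNT (ind e f eI fI) => ef; rewrite /line_graph ef.
  by apply/set0Pn; exists z; rewrite inE ze.
split=> -[m maxm].
  by split=> [|I]; rewrite -matE //; apply: maxm.
by split=> [|I]; rewrite matE //; apply: maxm.
Qed.

Lemma line_graph_irr : irreflexive (line_graph h).
Proof. by move=> e; rewrite /line_graph eqxx. Qed.

Lemma line_graph_meet e f z : e != f -> z \in val e -> z \in val f -> line_graph h e f.
Proof.
by move=> ef ze zf; rewrite /line_graph ef; apply/set0Pn; exists z; rewrite inE ze.
Qed.

Lemma star_clique v : clique (line_graph h) (star v).
Proof.
apply/cliqueP => e f; rewrite !inE => ve vf ef; exact: line_graph_meet ef ve vf.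
Qed.

Lemma star_strong v : strong_clique (line_graph h) (star v) <-> strong_vertex_in h [set: V] v.
Proof.
split=> [[_ str] M /maximal_matching_independent /str /set0Pn [e]|str].
  by case/setIP; rewrite inE; exists e.
split=> [|I /maximal_matching_independent /str [e eI ve]]; first exact: star_clique.
by apply/set0Pn; exists e; rewrite !inE ve.
Qed.

Lemma edge_card e : #|val e| = 2.
Proof. by have [x [y [hxy ->]]] := edgeP e; rewrite cards2 adj_neq. Qed.

Lemma card3_setD1 T x : #|T| = 3 -> 1 < #|T :\ x|.
Proof. by move=> T3; rewrite -ltnS -T3 (cardsD1 x T) -[leqRHS]add1n leq_add2r leq_b1. Qed.

(** Two disjoint edges inside [T] would need four vertices. *)
Lemma edges_in_clique T : #|T| = 3 -> clique (line_graph h) (edges_in T).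
Proof.
move=> T3; apply/cliqueP => e f; rewrite !inE => eT fT ef; rewrite /line_graph ef.
apply/eqP => ef0; have := cardsUI (val e) (val f).
have := subset_leq_card (_ : val e :|: val f \subset T).
by rewrite ef0 cards0 !edge_card subUset eT fT T3 => /(_ isT); case: #|_| => [|[|[|[]]]].
Qed.

Definition no_disjoint_exits T : Prop :=
  forall x y x' y', x \in T -> y \in T -> x != y -> x' \notin T -> y' \notin T ->
  h x x' -> h y y' -> x' = y'.

(** Two disjoint exits, put into a maximal matching, leave only one vertex of [T] free, too few for
    an edge inside [T]. Conversely, a maximal matching without an edge inside [T] provides two
    disjoint exits. *)
Lemma edges_in_strong T : triangle T ->
  strong_clique (line_graph h) (edges_in T) <-> no_disjoint_exits T.
Proof.
move=> /andP [/eqP T3 /cliqueP clT]; split=> [[_ str] x y x' y' xT yT xy x'T y'T hxx' hyy'|str].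
  apply/eqP; apply: contraT => x'y'.
  have [e eE] := edge_of hxx'; have [f fE] := edge_of hyy'.
  have ef z : z \in val e -> z \notin val f.
    rewrite eE fE !inE negb_or => /pred2P [] ->; rewrite ?xy ?x'y' ?andbT /=.
      by apply: contraTneq xT => ->.
    by apply: contraNneq x'T => ->.
  have matM : matching_in [set: V] [set e; f].
    apply/matchingP; split=> [k _|k l z]; first exact: subsetT.
    by move=> /set2P [] -> /set2P [] -> // => [/ef /negP|/[swap] /ef /negP].
  have [M maxM /subsetP sM] := maximal_matching_extend matM.
  have /set0Pn [k /setIP [kT kM]] := str M ((maximal_matching_independent M).1 maxM).
  rewrite inE in kT; have /matchingP [_ dis] := maxM.1.
  have nk z i : i \in M -> z \in val i -> ~~ (val i \subset T) -> z \notin val k.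
    move=> iM zi iT; apply: contraNN iT => zk; by rewrite (dis i k z).
  have xk : x \notin val k.
    apply: (nk x e); rewrite ?eE ?set21 ?sM ?set21 //.
    by rewrite subUset !sub1set (negPf x'T) andbF.
  have yk : y \notin val k.
    apply: (nk y f); rewrite ?fE ?set21 ?sM ?set22 //.
    by rewrite subUset !sub1set (negPf y'T) andbF.
  have: #|val k :|: [set x; y]| <= #|T|.
    by apply: subset_leq_card; rewrite !subUset kT !sub1set xT yT.
  rewrite cardsU edge_card cards2 xy T3 (_ : _ :&: _ = set0) ?cards0 //.
  apply/setP => z; rewrite !inE; apply/negP => /andP [zk /pred2P zE].
  by case: zE zk => ->; apply/negP.
split=> [|I /maximal_matching_independent maxI]; first exact: edges_in_clique.
apply: contraT => /negP noe; exfalso.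
have /matchingP [_ dis] := maxI.1.
have outI e : e \in I -> ~~ (val e \subset T).
  by move=> eI; apply/negP => eT; case: noe; apply/set0Pn; exists e; rewrite !inE eT eI.
(* At most one vertex of [T] is missed, so two are matched to the outside. *)
pose cov x := [exists e in I, x \in val e].
have covP x y : x \in T -> y \in T -> x != y -> cov x || cov y.
  move=> xT yT xy; case: (boolP (cov x)) => //= ncx.
  have [k kI yk] := maximal_matching_covers maxI (in_setT x) (in_setT y) (clT _ _ xT yT xy) ncx.
  by apply/exists_inP; exists k.
have exit x : x \in T -> cov x -> exists e y, [/\ e \in I, y \notin T, h x y & val e = [set x; y]].
  move=> xT /exists_inP [e eI xe]; have [y hxy eE] := edge_at xe.
  exists e, y; split=> //; apply: contra (outI e eI) => yT.
  by rewrite eE subUset !sub1set xT.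
have two x y : x \in T -> y \in T -> x != y -> cov x -> ~~ cov y.
  move=> xT yT xy cx; apply/negP => cy.
  have [e [x' [eI x'T hxx' eE]]] := exit x xT cx.
  have [f [y' [fI y'T hyy' fE]]] := exit y yT cy.
  have E := str x y x' y' xT yT xy x'T y'T hxx' hyy'.
  have ef : e = f by apply: (dis e f x'); rewrite ?eE ?fE ?E ?set22.
  have: x \in val f by rewrite -ef eE set21.
  by rewrite fE !inE (negPf xy) /= => /eqP xy'; rewrite -xy' xT in y'T.
have /card_gt0P [x xT] : 0 < #|T| by rewrite T3.
case/card_gt1P: (card3_setD1 x T3) => y [z [/setD1P [yx yT] /setD1P [zx zT] yz]].
rewrite eq_sym in yx; rewrite eq_sym in zx.
have := covP x y xT yT yx; have := covP x z xT zT zx; have := covP y z yT zT yz.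
have := two x y xT yT yx; have := two x z xT zT zx; have := two y z yT zT yz.
by case: (cov x); case: (cov y); case: (cov z) => //=; do ?[by move=> /(_ isT)|move=> _].
Qed.


(** Separates the edge set of a triangle from every star. *)
Lemma triangle_edge_avoiding T v : triangle T -> exists2 e, e \in edges_in T & v \notin val e.
Proof.
move=> /andP [/eqP T3 /cliqueP clT].
case/card_gt1P: (card3_setD1 v T3) => x [y [/setD1P [xv xT] /setD1P [yv yT] xy]].
have [e eE] := edge_of (clT x y xT yT xy); exists e.
  by rewrite inE eE subUset !sub1set xT.
by rewrite eE !inE negb_or eq_sym xv eq_sym.
Qed.

(** * Partitions of the line graph into strong cliques *)

Lemma strong_clique_line_graph (C : {set Edge h}) :
  strong_clique (line_graph h) C -> C != set0 ->
  (exists v, C = star v) \/ (exists2 T, triangle T & C = edges_in T).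
Proof.
move=> strC /set0Pn [e eC]; have /cliqueP clC := strC.1.
have meet f g : f \in C -> g \in C -> exists2 z, z \in val f & z \in val g.
  move=> fC gC; have [->|fg] := eqVneq f g.
    by have [x [y [_ gE]]] := edgeP g; exists x; rewrite gE set21.
  by case/andP: (clC f g fC gC fg) => _ /set0Pn [z /setIP [zf zg]]; exists z.
have starC v : {in C, forall f, v \in val f} -> C = star v.
  move=> vC; apply: (strong_clique_maximal line_graph_irr strC (star_clique v)).
  by apply/subsetP => f /vC; rewrite inE.
have [x [y [hxy eE]]] := edgeP e; have xy := adj_neq hxy.
(* If neither end of [e] lies on all edges of [C], then some [f] through [y] and some [g] through
   [x] close a triangle with [e]. *)
case: (boolP [forall f in C, x \in val f]) => [/forall_inP /starC ->|]; first by left; exists x.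
case/forall_inPn => f fC xf.
case: (boolP [forall f in C, y \in val f]) => [/forall_inP /starC ->|]; first by left; exists y.
case/forall_inPn => g gC yg; right.
have yf : y \in val f.
  by have [z] := meet e f eC fC; rewrite eE => /set2P [] -> //; rewrite (negPf xf).
have xg : x \in val g.
  by have [z] := meet e g eC gC; rewrite eE => /set2P [] -> //; rewrite (negPf yg).
have [z zf zg] := meet f g fC gC.
have zx : z != x by apply: contraNneq xf => <-.
have zy : z != y by apply: contraNneq yg => <-.
have fE := edge_of_two yf zf (_ : y != z); have gE := edge_of_two xg zg (_ : x != z).
rewrite eq_sym zy in fE; rewrite eq_sym zx in gE; move: (fE isT) (gE isT) => {}fE {}gE.
have hyz := edge_pair fE; have hxz := edge_pair gE.
have triT : triangle [set x; y; z].
  apply/andP; split; first by rewrite setUC cardsU1 !inE negb_or zx zy cards2 xy.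
  apply/cliqueP => u v; rewrite !inE -!orbA.
  by move=> /or3P [] /eqP -> /or3P [] /eqP ->; rewrite ?eqxx // => _; rewrite // hsym.
exists [set x; y; z] => //.
have /andP [/eqP T3 _] := triT.
apply: (strong_clique_maximal line_graph_irr strC (edges_in_clique T3)).
apply/subsetP => k kC; rewrite inE.
(* The three edges of the triangle have no common vertex, so the points where [k] meets them are not
   all equal, and both ends of [k] lie in the triangle. *)
have [p pe pk] := meet e k eC kC; have [q qf qk] := meet f k fC kC.
have [r rg rk] := meet g k gC kC.
have two u v : u \in val k -> v \in val k -> u != v -> u \in [set x; y; z] ->
    v \in [set x; y; z] -> val k \subset [set x; y; z].
  by move=> uk vk uv uT vT; rewrite (edge_of_two uk vk uv) subUset !sub1set uT vT.
have pT : p \in [set x; y; z] by move: pe; rewrite eE !inE => ->.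
have qT : q \in [set x; y; z].
  by move: qf; rewrite fE !inE => /orP [] ->; rewrite ?orbT.
have rT : r \in [set x; y; z].
  by move: rg; rewrite gE !inE => /orP [] ->; rewrite ?orbT.
have [pq|pq] := eqVneq p q; last exact: (two p q).
have [pr|pr] := eqVneq p r; last exact: (two p r).
move: pe qf rg; rewrite eE fE gE -pq -pr !inE => /pred2P [] ->.
  by rewrite (negPf xy) eq_sym (negPf zx).
by move=> _; rewrite eq_sym (negPf xy) eq_sym (negPf zy).
Qed.

(* [U] collects the centres of the stars and [TT] the triangles of a partition of the
   edges of [h] into strong cliques of its line graph. *)
Definition decomposition U (TT : {set {set V}}) : Prop :=
  [/\ forall u, u \in U -> strong_vertex_in h [set: V] u,
      forall x y, x \in U -> y \in U -> ~~ h x y,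
      forall T, T \in TT -> [/\ triangle T, no_disjoint_exits T & [disjoint T & U]],
      forall T T' x y, T \in TT -> T' \in TT -> x \in T -> x \in T' -> y \in T ->
        y \in T' -> x != y -> T = T' &
      forall x y, h x y -> [\/ x \in U, y \in U | exists T, [/\ T \in TT, x \in T & y \in T]]].

Lemma localizable_decomposition :
  localizable (line_graph h) -> exists U TT, decomposition U TT.
Proof.
case=> P [/and3P [/eqP covP /trivIsetP trivP P0] strP].
have uniqP A B e : A \in P -> B \in P -> e \in A -> e \in B -> A = B.
  move=> AP BP eA eB; apply/eqP; apply: contraT => /(trivP A B AP BP).
  by move/disjointFr => /(_ e eA); rewrite eB.
(* When [h] is a single edge, the stars of its two ends coincide, so every star
   needs a unique chosen centre. *)
pose centre (C : {set Edge h}) := [pick v | star v == C].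
pose U := [set v | (star v \in P) && (centre (star v) == Some v)].
pose TT := [set T | triangle T && (edges_in T \in P)].
have starU v : star v \in P -> exists2 u, u \in U & star u = star v.
  move=> vP; case E: (centre (star v)) => [u|].
    have uv : star u = star v by move: E; rewrite /centre; case: pickP => // w /eqP ? [<-].
    by exists u; rewrite ?inE uv // vP E eqxx.
  by move: E; rewrite /centre; case: pickP => // /(_ v); rewrite eqxx.
exists U, TT; split=> [u|x y|T|T T' x y|x y hxy].
- by rewrite inE => /andP [uP _]; apply/star_strong/strP.
- rewrite !inE => /andP [xP /eqP cx] /andP [yP /eqP cy]; apply/negP => hxy.
  have [e eE] := edge_of hxy.
  have sxy : star x = star y by apply: (uniqP _ _ e); rewrite // inE eE ?set21 ?set22.
  by move: cx; rewrite sxy cy => -[yx]; have := adj_neq hxy; rewrite yx eqxx.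
- rewrite inE => /andP [triT TP]; split=> //; first by apply/edges_in_strong => //; apply: strP.
  (* If a chosen centre [v] were in [T], its star and [edges_in T] would share an edge and hence
     coincide, but [T] has an edge avoiding [v]. *)
  apply/pred0Pn => -[v /andP [/= vT]]; rewrite inE => /andP [vP _].
  have [e eT /negP] := triangle_edge_avoiding v triT; apply.
  have /andP [/eqP T3 /cliqueP clT] := triT.
  case/card_gt0P: (ltnW (card3_setD1 v T3)) => w /setD1P [wv wT]; rewrite eq_sym in wv.
  have [f fE] := edge_of (clT v w vT wT wv).
  have /setP /(_ e) : star v = edges_in T.
    apply: (uniqP _ _ f) => //; first by rewrite inE fE set21.
    by rewrite inE fE subUset !sub1set vT wT.
  by rewrite eT inE.
- rewrite !inE => /andP [triT TP] /andP [triT' TP'] xT xT' yT yT' xy.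
  have /andP [_ /cliqueP clT] := triT; have [e eE] := edge_of (clT x y xT yT xy).
  (* Every vertex of a triangle lies on one of its edges, so the edge set determines the
     triangle. *)
  have sTT' S S' : triangle S -> edges_in S = edges_in S' -> S \subset S'.
    move=> triS ES; apply/subsetP => v vS; have /andP [/eqP S3 /cliqueP clS] := triS.
    case/card_gt0P: (ltnW (card3_setD1 v S3)) => w /setD1P [wv wS]; rewrite eq_sym in wv.
    have [f fE] := edge_of (clS v w vS wS wv).
    have: f \in edges_in S' by rewrite -ES inE fE subUset !sub1set vS wS.
    by rewrite inE fE => /subsetP; apply; rewrite set21.
  have ET : edges_in T = edges_in T'.
    by apply: (uniqP _ _ e); rewrite // inE eE subUset !sub1set ?xT ?xT' ?yT ?yT'.
  by apply/eqP; rewrite eqEsubset !sTT'.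
- have [e eE] := edge_of hxy; have: e \in cover P by rewrite covP in_setT.
  case/bigcupP => C CP eC.
  have C0 : C != set0 by apply: contraNneq P0 => <-.
  have [[v EC]|[T triT EC]] := strong_clique_line_graph (strP C CP) C0.
    have [|u uU su] := starU v; first by rewrite -EC.
    have: e \in star u by rewrite su -EC.
    by rewrite inE eE => /set2P [] <-; [constructor 1|constructor 2].
  constructor 3; exists T; split; first by rewrite inE triT -EC.
    by move: eC; rewrite EC inE eE => /subsetP; apply; rewrite set21.
  by move: eC; rewrite EC inE eE => /subsetP; apply; rewrite set22.
Qed.

Lemma decomposition_localizable U TT :
  decomposition U TT -> localizable (line_graph h).
Proof.
move=> [strU indU strT uniqT cov].
(* Isolated vertices of [U] have empty stars, which a partition must not contain. *)
pose P := [set star u | u in U & star u != set0] :|: [set edges_in T | T in TT].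
have PE C : C \in P -> (exists2 u, u \in U & C = star u) \/ (exists2 T, T \in TT & C = edges_in T).
  case/setUP => [/imsetP [u]|/imsetP [T TP ->]]; last by right; exists T.
  by rewrite inE => /andP [uU _] ->; left; exists u.
have disj e u T : u \in U -> T \in TT -> u \in val e -> ~~ (val e \subset T).
  move=> uU TP ue; apply/negP => /subsetP /(_ u ue) uT.
  by have [_ _ /disjointFl /(_ uU)] := strT T TP; rewrite uT.
exists P; split; last first.
  move=> C /PE [[u uU ->]|[T TP ->]]; first exact/star_strong/strU.
  by have [triT exT _] := strT T TP; apply/edges_in_strong.
apply/and3P; split.
- apply/eqP/setP => e; rewrite inE; have [x [y [hxy eE]]] := edgeP e.
  have starP u : u \in U -> u \in val e -> e \in cover P.
    move=> uU ue; apply/bigcupP; exists (star u); last by rewrite inE.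
    apply/setUP; left; apply/imsetP; exists u => //; rewrite inE uU.
    by apply/set0Pn; exists e; rewrite inE.
  have [/starP|/starP|[T [TP xT yT]]] := cov x y hxy.
  + by rewrite eE set21 => ->.
  + by rewrite eE set22 => ->.
  apply/bigcupP; exists (edges_in T); last by rewrite inE eE subUset !sub1set xT.
  by apply/setUP; right; apply/imsetP; exists T.
- apply/trivIsetP => A B AP BP; apply: contraR => /pred0Pn [e /andP [/= eA eB]].
  case: (PE A AP) eA => [[u uU ->]|[T TP ->]]; case: (PE B BP) eB => [[v vU ->]|[T' TP' ->]];
  rewrite !inE.
  + move=> ve ue; apply: contraT => suv.
    have uv : u != v by apply: contraNneq suv => ->.
    by have := indU u v uU vU; rewrite (edge_pair (edge_of_two ue ve uv)).
  + by move=> eT' ue; rewrite (negPf (disj e u T' uU TP' ue)) in eT'.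
  + by move=> ve eT; rewrite (negPf (disj e v T vU TP ve)) in eT.
  + have [x [y [hxy ->]]] := edgeP e; rewrite !subUset !sub1set.
    move=> /andP [xT' yT'] /andP [xT yT].
    by rewrite (uniqT T T' x y) ?(adj_neq hxy).
- apply/negP => /setUP [/imsetP [u]|/imsetP [T TP E]]; first by rewrite inE => /andP [_ /eqP u0] /esym.
  have [triT _ _] := strT T TP; have /andP [/eqP T3 _] := triT.
  have : 0 < #|T| by rewrite T3.
  case/card_gt0P => v _; have [e] := triangle_edge_avoiding v triT.
  by rewrite -E inE.
Qed.

(** * Pendant subgraphs, their non-root vertices and their roots *)

Lemma deg_gt_exit (A : {set V}) x : #|A| < deg h x -> exists2 y, h x y & y \notin A.
Proof.
move=> ltA; have /subsetPn [y] : ~~ ([set y | h x y] \subset A).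
  by apply: contraL ltA => /subset_leq_card; rewrite -leqNgt.
by rewrite inE; exists y.
Qed.

Lemma deg2_adj a b c : h a b -> h a c -> b != c -> deg h a = 2 -> h a =1 pred2 b c.
Proof.
move=> hab hac bc da; have/eqP E : [set b; c] == [set y | h a y].
  by rewrite eqEcard [X in X <= _]da cards2 bc subUset !sub1set !inE hab hac.
by move=> x; have /setP /(_ x) := E; rewrite !inE => <-.
Qed.

Lemma deg3_adj a b c d : h a b -> h a c -> h a d -> b != c -> b != d -> c != d ->
  deg h a = 3 -> h a =1 pred3 b c d.
Proof.
move=> hab hac had bc bd cd da; have/eqP E : [set b; c; d] == [set y | h a y].
  rewrite eqEcard [X in X <= _]da !subUset !sub1set !inE hab hac had /=.
  by rewrite setUC cardsU1 !inE negb_or cards2 bc eq_sym bd eq_sym cd.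
by move=> x; have /setP /(_ x) := E; rewrite !inE -orbA => <-.
Qed.

Lemma ptri_sym a b c : ptri h a b c -> ptri h b a c.
Proof. by case/and5P=> hab hbc hac da /andP [db dc]; rewrite /ptri hsym hab hac hbc da db. Qed.

Lemma pdiam_sym a b c d : pdiam h a b c d -> pdiam h a c b d.
Proof.
by rewrite /pdiam (hsym c b); case/and5P=> -> -> -> -> /and5P [-> -> -> -> /and3P [-> -> ->]].
Qed.

Lemma pK4_sym a b c d : pK4 h a b c d -> pK4 h b a c d.
Proof.
by rewrite /pK4 (hsym b a); case/and5P=> -> -> -> -> /and5P [-> -> -> -> /andP [-> ->]].
Qed.

Lemma pK4_rot a b c d : pK4 h a b c d -> pK4 h c a b d.
Proof.
rewrite /pK4 (hsym c a) (hsym c b).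
by case/and5P=> -> -> -> -> /and5P [-> -> -> -> /andP [-> ->]].
Qed.

Lemma ptri_adj a b c : ptri h a b c -> h a =1 pred2 b c /\ h b =1 pred2 a c.
Proof.
case/and5P=> hab hbc hac /eqP da /andP [/eqP db _]; split.
  exact: deg2_adj (adj_neq hbc) da.
by apply: deg2_adj (adj_neq hac) db; rewrite // hsym.
Qed.

Lemma pdiam_adj a b c d : pdiam h a b c d ->
  [/\ h a =1 pred2 b c, h b =1 pred3 a c d & h c =1 pred3 a b d].
Proof.
case/and5P=> hab hac hbc hbd /and5P [hcd _ ad /eqP da /and3P [/eqP db /eqP dc _]].
split; first exact: deg2_adj (adj_neq hbc) da.
  by apply: deg3_adj; rewrite ?(adj_neq hac) ?(adj_neq hcd) // hsym.
by apply: deg3_adj; rewrite ?(adj_neq hab) ?(adj_neq hbd) // hsym.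
Qed.

Lemma pK4_adj a b c d : pK4 h a b c d ->
  [/\ h a =1 pred3 b c d, h b =1 pred3 a c d & h c =1 pred3 a b d].
Proof.
case/and5P=> hab hac had hbc /and5P [hbd hcd /eqP da /eqP db /andP [/eqP dc _]].
by split; apply: deg3_adj; rewrite ?(adj_neq hac) ?(adj_neq hcd) ?(adj_neq hab)
  ?(adj_neq hbd) ?(adj_neq had) ?(adj_neq hbc) // hsym.
Qed.

(** The eight positions listed in [nonroots] reduce to four up to the symmetries of the pendant
    subgraphs; the second argument keeps the root. *)
Inductive attached : V -> V -> Prop :=
| attached_tri a b c of ptri h a b c : attached a c
| attached_tip a b c d of pdiam h a b c d : attached a d
| attached_mid a b c d of pdiam h a b c d : attached b d
| attached_K4 a b c d of pK4 h a b c d : attached a d.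

Lemma nonrootsP x : x \in nonroots h <-> exists r, attached x r.
Proof.
split=> [|[r att]].
  rewrite inE -!orbA => /or4P [||| /or4P [||| /orP []]].
  - by case/existsP => b /existsP [c p]; exists c; apply: attached_tri p.
  - by case/existsP => a /existsP [c /ptri_sym p]; exists c; apply: attached_tri p.
  - by case/existsP => b /existsP [c /existsP [d p]]; exists d; apply: attached_tip p.
  - by case/existsP => a /existsP [c /existsP [d p]]; exists d; apply: attached_mid p.
  - by case/existsP => a /existsP [b /existsP [d /pdiam_sym p]]; exists d; apply: attached_mid p.
  - by case/existsP => b /existsP [c /existsP [d p]]; exists d; apply: attached_K4 p.
  - by case/existsP => a /existsP [c /existsP [d /pK4_sym p]]; exists d; apply: attached_K4 p.
  - by case/existsP => a /existsP [b /existsP [d /pK4_rot p]]; exists d; apply: attached_K4 p.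
rewrite inE -!orbA; case: att => a b c => [p|d p|d p|d p].
- apply/orP; left; apply/existsP; exists b; apply/existsP; by exists c.
- apply/or3P; constructor 3; apply/orP; left.
  apply/existsP; exists b; apply/existsP; exists c; apply/existsP; by exists d.
- apply/or4P; constructor 4; apply/orP; left.
  apply/existsP; exists a; apply/existsP; exists c; apply/existsP; by exists d.
- apply/or4P; constructor 4; apply/or3P; constructor 3; apply/orP; left.
  apply/existsP; exists b; apply/existsP; exists c; apply/existsP; by exists d.
Qed.

(** The prescribed degree of a non-root vertex is used up inside its pendant subgraph. *)
Lemma attached_adj x r y : attached x r -> h x y -> y = r \/ attached y r.
Proof.
case=> a b c => [p|d p|d p|d p].
- have [-> _] := ptri_adj p => /pred2P [->|->]; last by left.
  by right; apply: attached_tri (ptri_sym p).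
- have [-> _ _] := pdiam_adj p => /pred2P [] ->; right; first exact: attached_mid p.
  exact: attached_mid (pdiam_sym p).
- have [_ -> _] := pdiam_adj p => /or3P [] /eqP ->; [right|right|by left].
    exact: attached_tip p.
  exact: attached_mid (pdiam_sym p).
- have [-> _ _] := pK4_adj p => /or3P [] /eqP ->; [right|right|by left].
    exact: attached_K4 (pK4_sym p).
  exact: attached_K4 (pK4_rot p).
Qed.

Lemma attached_deg_le3 x r : attached x r -> deg h x <= 3.
Proof.
case=> a b c => [|d|d|d].
- by case/and5P=> _ _ _ /eqP ->.
- by case/and5P=> _ _ _ _ /and5P [_ _ _ /eqP -> _].
- by case/and5P=> _ _ _ _ /and5P [_ _ _ _ /and3P [/eqP -> _ _]].
- by case/and5P=> _ _ _ _ /and5P [_ _ /eqP -> _ _].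
Qed.

Lemma pdiam_deg a b c d : pdiam h a b c d ->
  [/\ deg h a = 2, deg h b = 3, deg h c = 3 & 2 < deg h d].
Proof.
by case/and5P=> _ _ _ _ /and5P [_ _ _ /eqP -> /and3P [/eqP -> /eqP -> ->]].
Qed.

Lemma pK4_deg a b c d : pK4 h a b c d ->
  [/\ deg h a = 3, deg h b = 3, deg h c = 3 & 3 < deg h d].
Proof.
by case/and5P=> _ _ _ _ /and5P [_ _ /eqP -> /eqP -> /andP [/eqP -> ->]].
Qed.

Lemma pdiam_adj_deg2 a b c d y : pdiam h a b c d -> h b y -> deg h y = 2 -> y = a.
Proof.
move=> p; have [_ -> _] := pdiam_adj p; have [_ _ dc dd] := pdiam_deg p.
by case/or3P => /eqP -> // dy; [rewrite dy in dc|rewrite dy in dd].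
Qed.

Lemma pK4_adj_deg a b c d y : pK4 h a b c d -> h a y -> 2 < deg h y.
Proof.
move=> p; have [-> _ _] := pK4_adj p; have [_ db dc dd] := pK4_deg p.
by case/or3P => /eqP ->; rewrite ?db ?dc // ltnW.
Qed.

(** The neighbours of [r] would be [a'], [c'] and [s]; since [a'] has degree 2 and [b], [c] have
    degree 3, one of [b], [c] is [c']. Its neighbour [a'] of degree 2 is then [a], which is not
    adjacent to [r]. *)
Lemma pdiam_root_not_pdiam a b c r a' c' s : pdiam h a b c r -> ~ pdiam h a' r c' s.
Proof.
wlog bc' : b c / b == c' => [wl|] p p'.
  have [_ Nb Nc] := pdiam_adj p; have [_ db dc _] := pdiam_deg p.
  have [da' _ _ _] := pdiam_deg p'.
  have [_ Nr _] := pdiam_adj p'.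
  case: (boolP (b == c')) => [bc'|bc']; first exact: (wl b c).
  case: (boolP (c == c')) => [cc'|cc']; first exact: (wl c b) (pdiam_sym p) p'.
  have rb : h r b by rewrite hsym Nb /= eqxx !orbT.
  have rc : h r c by rewrite hsym Nc /= eqxx !orbT.
  have bs : b = s.
    by move: rb; rewrite Nr /= (negPf bc') => /orP [/eqP E|/eqP //]; rewrite E da' in db.
  have cs : c = s.
    by move: rc; rewrite Nr /= (negPf cc') => /orP [/eqP E|/eqP //]; rewrite E da' in dc.
  have := Nb b; rewrite hirr /= {2}bs -cs eqxx orbT //.
move: p'; rewrite -(eqP bc') => p' {c' bc'}.
have [Na' Nr' _] := pdiam_adj p'; have [da' _ _ _] := pdiam_deg p'.
have E : a' = a.
  by apply: pdiam_adj_deg2 p _ da'; rewrite hsym Na' /= eqxx orbT.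
case/and5P: p => _ _ _ _ /and5P [_ /negP har _ _ _]; apply: har.
by rewrite -E Na' /= eqxx.
Qed.

(** The neighbours of [r] would be [b'], [c'] and [s], so one of [b], [c] is [b'] or [c']. It is
    adjacent to the tip [a] of degree 2, whereas a non-root vertex of a pendant [K_4] has only
    neighbours of degree at least 3. *)
Lemma pdiam_root_not_pK4 a b c r b' c' s : pdiam h a b c r -> ~ pK4 h r b' c' s.
Proof.
wlog bb : b c b' c' / b == b' => [wl|] p p'.
  have [_ Nb Nc] := pdiam_adj p; have [Nr _ _] := pK4_adj p'.
  have rb : h r b by rewrite hsym Nb /= eqxx !orbT.
  have rc : h r c by rewrite hsym Nc /= eqxx !orbT.
  have p2 : pK4 h r c' b' s := pK4_rot (pK4_rot (pK4_sym p')).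
  have q := pdiam_sym p.
  move: rb rc; rewrite !Nr => /or3P [bE|bE|/eqP bs].
  - by move=> _; apply: (wl b c b' c').
  - by move=> _; apply: (wl b c c' b').
  case/or3P => [cE|cE|/eqP cs]; first exact: (wl c b b' c').
    exact: (wl c b c' b').
  by have := Nb b; rewrite hirr /= {2}bs -cs eqxx orbT.
have [da _ _ _] := pdiam_deg p.
have hba : h b' a by have [_ Nb _] := pdiam_adj p; rewrite -(eqP bb) Nb /= eqxx.
by have := pK4_adj_deg (pK4_sym p') hba; rewrite da.
Qed.

(** A root could be lost as a non-root vertex of another pendant subgraph. Having degree at least 3,
    it would be a middle vertex of a pendant diamond or lie in a pendant [K_4]; the degrees around
    it and the non-adjacency of tips exclude both. *)
Lemma root_reduction x r : attached x r -> r \in pendant_reduction h.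
Proof.
move=> xr; rewrite inE; apply/negP => /nonrootsP [s rs].
have dr : 2 < deg h r.
  case: (xr) => [a b c /and5P [_ _ _ _ /andP [_ //]]|a b c d|a b c d|a b c d].
  - by case/pdiam_deg.
  - by case/pdiam_deg.
  - by case/pK4_deg => _ _ _ /ltnW.
have mid_or_K4 : (exists a c, pdiam h a r c s) \/ (exists b c, pK4 h r b c s).
  case: rs dr => [a b c /and5P [_ _ _ /eqP -> //]|a b c d /pdiam_deg [-> //]|a b c d p _|a b c d p _].
    by left; exists a, c.
  by right; exists b, c.
case: xr rs dr mid_or_K4 => {x r} [a b r|a b c r|b a c r|a b c r] p rs dr.
- have /and5P [hab hbr har /eqP da /andP [/eqP db _]] := p.
  case=> [[a' [c' p']]|[b' [c' p']]].
    have := adj_neq hab; rewrite (pdiam_adj_deg2 p' _ da) 1?hsym //.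
    by rewrite (pdiam_adj_deg2 p' _ db) ?eqxx // hsym.
  by have := pK4_adj_deg p' (etrans (hsym r a) har); rewrite da.
- case=> [[a' [c' p']]|[b' [c' p']]]; first exact: pdiam_root_not_pdiam p p'.
  exact: pdiam_root_not_pK4 p p'.
- case=> [[a' [c' p']]|[b' [c' p']]]; first exact: pdiam_root_not_pdiam p p'.
  exact: pdiam_root_not_pK4 p p'.
- by have := attached_deg_le3 rs; have [_ _ _ /ltn_geF ->] := pK4_deg p.
Qed.

Lemma attached_adj_reduction x r y :
  attached x r -> y \in pendant_reduction h -> h x y -> y = r.
Proof.
move=> xr yF /(attached_adj xr) [//|yr]; move: yF; rewrite inE => /negP [].
by apply/nonrootsP; exists r.
Qed.

(** * Strength of the vertices of pendant subgraphs *)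

Lemma strong_center_pair a b c : h a =1 pred2 b c -> h b c ->
  ~ strong_vertex_in h [set: V] a.
Proof.
move=> Na hbc /(@strong_no_escape _ _ (fun w => if w == b then c else b)); apply.
have bc := adj_neq hbc; have cb : (c == b) = false by rewrite eq_sym (negPf bc).
have ab : h a b by rewrite Na /= eqxx.
have ac : h a c by rewrite Na /= eqxx orbT.
split=> [w _|w w' _ + _]; rewrite !Na => /pred2P.
  by case=> ->; rewrite ?eqxx ?cb in_setT eq_sym adj_neq // hsym.
by case=> -> /pred2P [] ->; rewrite ?eqxx ?cb; split=> // E; rewrite E ?eqxx in bc *.
Qed.

(** In the escape, [b] and [c] are matched to each other and [d] to a vertex [d'] that is not a
    neighbour of [a]. *)
Lemma strong_center_triple a b c d d' : h a =1 pred3 b c d -> h b c -> b != d -> c != d ->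
  h d d' -> d' != a -> ~~ h a d' -> ~ strong_vertex_in h [set: V] a.
Proof.
move=> Na hbc bd cd hdd' d'a had'.
move=> /(@strong_no_escape _ _ (fun w => if w == d then d' else if w == b then c else b)).
apply; have bc := adj_neq hbc; have cb : (c == b) = false by rewrite eq_sym (negPf bc).
move: had'; rewrite Na /= !negb_or => /and3P [d'b d'c d'd].
have ab : h a b by rewrite Na /= eqxx.
have ac : h a c by rewrite Na /= eqxx orbT.
split=> [w _|w w' _ + _]; rewrite !Na => /or3P [] /eqP ->.
- by rewrite (negPf bd) eqxx in_setT eq_sym adj_neq.
- by rewrite (negPf cd) cb in_setT eq_sym adj_neq // hsym.
- by rewrite eqxx in_setT.
all: case/or3P => /eqP ->; rewrite ?(negPf bd) ?(negPf cd) ?cb ?eqxx; split=> // E;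
  by rewrite ?E -?E ?eqxx // in bc bd cd d'b d'c d'd cb *.
Qed.

(** A non-root vertex of degree 2 has adjacent neighbours, which can be matched to each other. In
    the remaining cases two neighbours are matched to each other and the root is matched outside the
    pendant subgraph. *)
Lemma attached_not_strong x r : attached x r -> ~ strong_vertex_in h [set: V] x.
Proof.
case=> a b c => [p|d p|d p|d p].
- by have [Na _] := ptri_adj p; case/and5P: p => _ hbc _ _ _; apply: strong_center_pair Na hbc.
- by have [Na _ _] := pdiam_adj p; case/and5P: p => _ _ hbc _ _; apply: strong_center_pair Na hbc.
- have [_ Nb _] := pdiam_adj p; have [_ _ _ dd] := pdiam_deg p.
  case/and5P: p => hab hac hbc hbd /and5P [hcd had ad _ _].
  (* The root [d] has a neighbour [d'] besides [b] and [c]; it is not the tip [a], which is not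
     adjacent to [d]. *)
  have [|d' hdd'] := @deg_gt_exit [set b; c] d; first by rewrite cards2 adj_neq.
  rewrite !inE negb_or => /andP [d'b d'c].
  apply: (strong_center_triple Nb hac ad (adj_neq hcd) hdd' d'b).
  rewrite Nb /= (negPf d'c) (eq_sym _ d) (negPf (adj_neq hdd')) /= orbF.
  by apply: contraNneq had => <-; rewrite hsym.
- have [Na _ _] := pK4_adj p; have [_ _ _ dd] := pK4_deg p.
  case/and5P: p => hab hac had hbc /and5P [hbd hcd _ _ _].
  have [|d' hdd'] := @deg_gt_exit [set a; b; c] d.
    by apply: leq_trans dd; rewrite setUC cardsU1 cards2; case: (c \notin _); case: (_ != _).
  rewrite !inE !negb_or => /andP [/andP [d'a d'b] d'c].
  apply: (strong_center_triple Na hbc (adj_neq hbd) (adj_neq hcd) hdd' d'a).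
  by rewrite Na /= (negPf d'b) (negPf d'c) eq_sym (negPf (adj_neq hdd')).
Qed.

(* A matching missing [v] would pair up the three vertices [a], [b], [c]. *)
Lemma no_escape_K4 v a b c m : h v a -> h v b -> h v c -> h a b -> h a c -> h b c ->
  h a =1 pred3 b c v -> h b =1 pred3 a c v -> h c =1 pred3 a b v -> ~ escape [set: V] v m.
Proof.
move=> va vb vc hab hac hbc Na Nb Nc [mP mI].
have [_ mav ham] := mP a (in_setT _) va; have [_ mcv hcm] := mP c (in_setT _) vc.
have [_ mbv hbm] := mP b (in_setT _) vb.
have inj w w' : h v w -> h v w' -> m w = m w' -> w = w'.
  by move=> hw hw'; case: (mI w w' (in_setT _) hw (in_setT _) hw').
have inv w w' : h v w -> h v w' -> m w = w' -> m w' = w.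
  by move=> hw hw'; case: (mI w w' (in_setT _) hw (in_setT _) hw').
have nab := adj_neq hab; have nac := adj_neq hac; have nbc := adj_neq hbc.
move: ham hcm hbm; rewrite Na Nb Nc /= (negPf mav) (negPf mbv) (negPf mcv) !orbF.
move=> /pred2P [] Ea.
  have Eb := inv a b va vb Ea; move=> /pred2P [] Ec _.
    by have := inj b c vb vc (etrans Eb (esym Ec)); apply/eqP.
  by have := inj a c va vc (etrans Ea (esym Ec)); apply/eqP.
have Ec := inv a c va vc Ea; move=> _ /pred2P [] Eb.
  by have := inj b c vb vc (etrans Eb (esym Ec)); apply/eqP.
by have := inj a b va vb (etrans Ea (esym Eb)); apply/eqP.
Qed.

Lemma pK4_root_strong a b c d : pK4 h a b c d -> strong_vertex_in h [set: V] d.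
Proof.
move=> p; have [Na Nb Nc] := pK4_adj p; apply: no_escape_strong => // m.
case/and5P: p => hab hac had hbc /and5P [hbd hcd _ _ _].
by apply: (no_escape_K4 (a := a) (b := b) (c := c)); rewrite // hsym.
Qed.

(** * Triangles whose edges form a strong clique *)

Lemma triangle_third T x y : triangle T -> x \in T -> y \in T -> x != y ->
  exists z, [/\ T = [set x; y; z], h x y, h x z & h y z].
Proof.
move=> /andP [/eqP T3 /cliqueP clT] xT yT xy.
have : #|T :\ x :\ y| == 1.
  by move: T3; rewrite (cardsD1 x) (cardsD1 y (T :\ x)) xT !inE eq_sym xy yT !add1n => -[->].
case/cards1P => z zE.
have : z \in T :\ x :\ y by rewrite zE set11.
rewrite !inE => /and3P [zy zx zT]; exists z.
split; [|exact: clT|by apply: clT; rewrite // eq_sym..].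
by rewrite -setUA -zE setD1K ?setD1K // !inE eq_sym xy.
Qed.

Lemma triangleP T : triangle T -> exists a b c, [/\ T = [set a; b; c], h a b, h a c & h b c].
Proof.
move=> triT; have /andP [/eqP T3 _] := triT.
have /card_gt1P [x [y [xT yT xy]]] : 1 < #|T| by rewrite T3.
by have [z ?] := triangle_third triT xT yT xy; exists x, y, z.
Qed.

Lemma triangle3 a b c : h a b -> h a c -> h b c -> triangle [set a; b; c].
Proof.
move=> hab hac hbc; apply/andP; split.
  by rewrite setUC cardsU1 !inE negb_or cards2 !(eq_sym c) !adj_neq.
apply/cliqueP => u v; rewrite !inE -!orbA.
by move=> /or3P [] /eqP -> /or3P [] /eqP ->; rewrite ?eqxx // => _; rewrite // hsym.
Qed.

(** The candidate triangles of a decomposition: a pendant triangle includes its root, while the root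
    [d] of a pendant diamond or [K_4] stays outside. *)
Inductive core : {set V} -> Prop :=
| core_tri a b c of ptri h a b c : core [set a; b; c]
| core_diam a b c d of pdiam h a b c d : core [set a; b; c]
| core_K4 a b c d of pK4 h a b c d : core [set a; b; c].

Lemma core_triangle T : core T -> triangle T.
Proof.
case=> a b c => [/and5P [? ? ? _ _]|d /and5P [? ? ? _ _]|d /and5P [? ? _ ? _]];
exact: triangle3.
Qed.

(** All exits of a pendant triangle start at its root; in the other two cases all exits end at the
    root [d]. *)
Lemma core_no_disjoint_exits T : core T -> no_disjoint_exits T.
Proof.
case=> a b c => [p|d p|d p] x y x' y'; rewrite !inE -!orbA.
- have [Na Nb] := ptri_adj p.
  by move=> /or3P [] /eqP -> /or3P [] /eqP ->; rewrite ?eqxx ?Na ?Nb //= => _;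
    rewrite ?negb_or => /and3P [/negPf xa /negPf xb /negPf xc] /and3P [/negPf ya /negPf yb /negPf yc];
    rewrite ?xa ?xb ?xc ?ya ?yb ?yc.
- have [Na Nb Nc] := pdiam_adj p.
  by move=> /or3P [] /eqP -> /or3P [] /eqP ->; rewrite ?eqxx ?Na ?Nb ?Nc /= => _;
    rewrite ?negb_or => /and3P [/negPf xa /negPf xb /negPf xc] /and3P [/negPf ya /negPf yb /negPf yc];
    rewrite ?xa ?xb ?xc ?ya ?yb ?yc //= => /eqP -> /eqP ->.
- have [Na Nb Nc] := pK4_adj p.
  by move=> /or3P [] /eqP -> /or3P [] /eqP ->; rewrite ?eqxx ?Na ?Nb ?Nc /= => _;
    rewrite ?negb_or => /and3P [/negPf xa /negPf xb /negPf xc] /and3P [/negPf ya /negPf yb /negPf yc];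
    rewrite ?xa ?xb ?xc ?ya ?yb ?yc //= => /eqP -> /eqP ->.
Qed.

(** At most one vertex of a core survives in the reduction, so no edge of the reduction lies inside
    a core. *)
Lemma core_attached T x y : core T -> x \in T -> y \in T -> x != y ->
  x \in nonroots h \/ y \in nonroots h.
Proof.
have nrI u r : attached u r -> u \in nonroots h by move=> ur; apply/nonrootsP; exists r.
case=> a b c => [p|d p|d p] xT yT xy; rewrite !inE -!orbA in xT yT.
- have an := nrI _ _ (attached_tri p); have bn := nrI _ _ (attached_tri (ptri_sym p)).
  by case/or3P: xT xy => /eqP ->; case/or3P: yT => /eqP ->; rewrite ?eqxx //; auto.
- have an := nrI _ _ (attached_tip p); have bn := nrI _ _ (attached_mid p).
  have cn := nrI _ _ (attached_mid (pdiam_sym p)).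
  by case/or3P: xT => /eqP ->; left.
- have an := nrI _ _ (attached_K4 p); have bn := nrI _ _ (attached_K4 (pK4_sym p)).
  have cn := nrI _ _ (attached_K4 (pK4_rot p)).
  by case/or3P: xT => /eqP ->; left.
Qed.

Lemma attached_core x r : attached x r -> exists2 T, core T & x \in T.
Proof.
case=> a b c => [p|d p|d p|d p]; exists [set a; b; c]; rewrite ?inE ?eqxx ?orbT //.
- exact: core_tri.
- exact: core_diam p.
- exact: core_diam p.
- exact: core_K4 p.
Qed.

Lemma deg_pred2 a b c : h a =1 pred2 b c -> b != c -> deg h a = 2.
Proof.
move=> Na bc; rewrite /deg (_ : [set y | h a y] = [set b; c]) ?cards2 ?bc //.
by apply/setP => x; rewrite !inE Na.
Qed.

Lemma deg_pred3 a b c d : h a =1 pred3 b c d -> b != c -> b != d -> c != d -> deg h a = 3.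
Proof.
move=> Na bc bd cd; rewrite /deg (_ : [set y | h a y] = d |: [set b; c]).
  by rewrite cardsU1 cards2 bc !inE !(eq_sym d) negb_or bd cd.
by apply/setP => x; rewrite !inE Na /= orbA orbC.
Qed.

Lemma isomorphic_seq n (g : rel 'I_n) (s : seq V) x0 :
  uniq s -> size s = n -> (forall x, x \in s) ->
  (forall i j : 'I_n, h (nth x0 s i) (nth x0 s j) = g i j) -> isomorphic h g.
Proof.
move=> uniq_s sz full hg.
have idx x : index x s < n by rewrite -sz index_mem.
exists (fun x => Ordinal (idx x)); split=> [|x y]; last by rewrite -hg /= !nth_index.
exists (fun i : 'I_n => nth x0 s i) => [x|i]; first by rewrite /= nth_index.
by apply: val_inj; rewrite /= index_uniq // sz.
Qed.

Lemma connected_closed (D : V -> Prop) x : connected_on h [set: V] -> D x ->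
  (forall y z, D y -> h y z -> D z) -> forall y, D y.
Proof.
move=> [_ conn] Dx clD y; have /connectP [p xp ->] := conn x y (in_setT x) (in_setT y).
elim: p x Dx xp => //= z p IH x Dx /andP [/and3P [hxz _ _] zp].
by apply: IH zp; apply: clD hxz.
Qed.

Lemma reduction_connected : connected_on h [set: V] ->
  connected_on h (pendant_reduction h).
Proof.
move=> conn; split=> [|s t sF tF].
  have [/set0Pn [x _] _] := conn; apply/set0Pn.
  case: (boolP (x \in nonroots h)) => [/nonrootsP [r xr]|xF].
    by exists r; apply: root_reduction xr.
  by exists x; rewrite inE.
(* Vertices are projected to the reduction, a non-root vertex going to its root; [D y] says that a
   projection of [y] is reachable from [s]. *)
pose D y := exists r, [/\ r \in pendant_reduction h,
  connect (induced h (pendant_reduction h)) s r & y = r \/ attached y r].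
have [|y z [r [rF sr yr]] hyz|r [rF sr [-> //|tr]]] := @connected_closed D s conn _ _ t.
- by exists s; split=> //; left.
- case: yr => [yr|yr]; last first.
    have [->|zr] := attached_adj yr hyz; first by exists r; split=> //; left.
    by exists r; split=> //; right.
  rewrite yr in hyz; case: (boolP (z \in nonroots h)) => [/nonrootsP [r' zr']|zF].
    exists r; split=> //; right.
    by rewrite (attached_adj_reduction zr' rF) // hsym.
  have {}zF : z \in pendant_reduction h by rewrite inE.
  exists z; split=> //; last by left.
  by apply: connect_trans sr (connect1 _); rewrite /induced hyz rF zF.
- by case/negP: (tF); move: tF; rewrite inE => /negP []; apply/nonrootsP; exists r.
Qed.

(** Only [c] can have exits. If its degree is at most 2 it has none, and connectedness leaves just
    three vertices; otherwise the triangle is pendant. *)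
Lemma triangle_one_exit a b c : connected_on h [set: V] -> h a b -> h a c -> h b c ->
  (forall y, h a y -> y \in [set a; b; c]) -> (forall y, h b y -> y \in [set a; b; c]) ->
  isomorphic h K3 \/ core [set a; b; c].
Proof.
move=> conn hab hac hbc Na Nb; have ab := adj_neq hab; have ac := adj_neq hac.
have bc := adj_neq hbc; case: (leqP (deg h c) 2) => dc; last first.
  have {}Na : h a =1 pred2 b c.
    move=> x; apply/idP/pred2P => [hax|[] -> //]; have := Na x hax.
    by rewrite !inE (eq_sym x) (negPf (adj_neq hax)) => /pred2P.
  have {}Nb : h b =1 pred2 a c.
    move=> x; apply/idP/pred2P => [hbx|[] -> //]; last by rewrite hsym.
    have := Nb x hbx; rewrite !inE -orbA orbCA (eq_sym x b) (negPf (adj_neq hbx)).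
    by move/pred2P.
  right; apply: core_tri; apply/and5P; split=> //; first by rewrite (deg_pred2 Na).
  by rewrite (deg_pred2 Nb) ?dc.
have Nc y : h c y -> y \in [set a; b; c].
  move=> hcy; apply: contraT; rewrite !inE !negb_or => /andP [/andP [ya yb] _].
  move: dc; rewrite leqNgt => /negP []; apply: (@leq_trans #|y |: [set a; b]|).
    by rewrite cardsU1 cards2 ab !inE negb_or ya yb.
  by apply: subset_leq_card; rewrite !subUset !sub1set !inE hcy !(hsym c) hac hbc.
left; apply: (@isomorphic_seq _ _ [:: a; b; c] a) => //.
- by rewrite /= !inE negb_or ab ac bc.
- move=> x; apply: (connected_closed (D := fun x => x \in [:: a; b; c]) (x := a) conn) => [|y z].
    by rewrite inE eqxx.
  by rewrite !inE => /or3P [] /eqP -> => [/Na|/Nb|/Nc]; rewrite !inE -orbA.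
- by case=> [[|[|[]]] // ?] [[|[|[]]] // ?]; rewrite /K3 /= ?hirr // hsym.
Qed.

(** All exits end at [d]. If [d] has no neighbour beyond the triangle, connectedness leaves just
    four vertices; otherwise [d] is the root of a pendant [K_4] or diamond, according to whether it
    is adjacent to [a]. *)
Lemma triangle_two_exits a b c d : connected_on h [set: V] -> h a b -> h a c -> h b c ->
  d \notin [set a; b; c] -> h b d -> h c d ->
  (forall x y, x \in [set a; b; c] -> y \notin [set a; b; c] -> h x y -> y = d) ->
  [\/ isomorphic h K4, isomorphic h diamond | core [set a; b; c]].
Proof.
move=> conn hab hac hbc dT hbd hcd exit.
have ab := adj_neq hab; have ac := adj_neq hac; have bc := adj_neq hbc.
have bd := adj_neq hbd; have cd := adj_neq hcd.
have ad : a != d by apply: contraNneq dT => <-; rewrite !inE eqxx.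
have nbr x y : x \in [set a; b; c] -> h x y -> [|| y == a, y == b, y == c | y == d].
  move=> xT hxy; have := exit x y xT _ hxy; rewrite !inE.
  by case: (y == a) (y == b) (y == c) => [] [] [] //= /(_ isT) ->.
have Nb : h b =1 pred3 a c d.
  move=> x; apply/idP/or3P => [hbx|[] /eqP -> //]; last by rewrite hsym.
  have := nbr b x; rewrite !inE eqxx orbT => /(_ isT hbx); rewrite orbCA (eq_sym x b).
  by rewrite (negPf (adj_neq hbx)) /= => /or3P.
have Nc : h c =1 pred3 a b d.
  move=> x; apply/idP/or3P => [hcx|[] /eqP -> //]; try by rewrite hsym.
  have := nbr c x; rewrite !inE eqxx orbT => /(_ isT hcx).
  by rewrite (eq_sym x c) (negPf (adj_neq hcx)) /= => /or3P.
have db := deg_pred3 Nb ac ad cd; have dc := deg_pred3 Nc ab ad bd.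
(* A neighbour [y] of [d] beyond the four vertices raises the degree of [d] above the number of its
   neighbours in the triangle, as the degree condition on a root requires. *)
have dNd y : h d y -> y \notin [:: a; b; c; d] -> forall A : {set V},
    A \subset [set a; b; c] -> (forall z, z \in A -> h d z) -> #|A| < deg h d.
  move=> hdy yn A /subsetP sA hA; apply: (@leq_trans #|y |: A|).
    rewrite cardsU1; case: (boolP (y \in A)) => // /sA.
    by move: yn; rewrite !inE -!orbA !negb_or => /and4P [/negPf -> /negPf -> /negPf ->].
  apply: subset_leq_card; rewrite subUset sub1set inE hdy.
  by apply/subsetP => z /hA; rewrite inE.
have full : (forall y, h d y -> y \in [:: a; b; c; d]) -> forall x, x \in [:: a; b; c; d].
  move=> Nd x; apply: (connected_closed (D := fun x => x \in [:: a; b; c; d]) (x := a) conn).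
    by rewrite inE eqxx.
  move=> y z; rewrite !inE => /or4P [] /eqP ->; try by [apply: nbr; rewrite !inE eqxx ?orbT].
  by move=> /Nd; rewrite !inE.
have unq : uniq [:: a; b; c; d] by rewrite /= !inE !negb_or ab ac bc bd cd ad.
case: (boolP [forall y, h d y ==> (y \in [:: a; b; c; d])]) => [/forallP Nd|].
  have {}full := full (fun y => implyP (Nd y)).
  case: (boolP (h a d)) => [had|/negPf had].
    constructor 1; apply: (@isomorphic_seq _ _ [:: a; b; c; d] a) => //.
    by case=> [[|[|[|[]]]] // ?] [[|[|[|[]]]] // ?]; rewrite /K4 /= ?hirr // hsym.
  constructor 2; apply: (@isomorphic_seq _ _ [:: a; b; c; d] a) => //.
  by case=> [[|[|[|[]]]] // ?] [[|[|[|[]]]] // ?]; rewrite /diamond /= ?hirr // hsym.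
case/forallPn => y; rewrite negb_imply => /andP [hdy yn]; constructor 3.
case: (boolP (h a d)) => [had|had].
  have Na : h a =1 pred3 b c d.
    move=> x; apply/idP/or3P => [hax|[] /eqP -> //].
    have := nbr a x; rewrite !inE eqxx => /(_ isT hax).
    by rewrite (eq_sym x a) (negPf (adj_neq hax)) /= => /or3P.
  apply: (@core_K4 a b c d); apply/and5P; split=> //; apply/and5P; split=> //.
  - by rewrite (deg_pred3 Na bc bd cd).
  - by rewrite db.
  rewrite dc eqxx; have /andP [/eqP <- _] := triangle3 hab hac hbc.
  apply: (dNd y) => // z; rewrite !inE -orbA hsym.
  by case/or3P => /eqP ->.
have Na : h a =1 pred2 b c.
  move=> x; apply/idP/pred2P => [hax|[] -> //].
  have := nbr a x; rewrite !inE eqxx => /(_ isT hax).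
  rewrite (eq_sym x a) (negPf (adj_neq hax)) /= => /or3P [] /eqP E; [by left|by right|].
  by rewrite -E hax in had.
apply: (@core_diam a b c d); apply/and5P; split=> //; apply/and5P; split=> //.
  by rewrite (deg_pred2 Na bc).
rewrite db dc !eqxx; have <- : #|[set b; c]| = 2 by rewrite cards2 bc.
apply: (dNd y) => // [|z]; first by rewrite -setUA subsetUr.
by rewrite !inE hsym => /pred2P [] ->.
Qed.

Lemma strong_triangle_cases T : connected_on h [set: V] -> triangle T ->
  no_disjoint_exits T ->
  isomorphic h K3 \/ isomorphic h K4 \/ isomorphic h diamond \/ core T.
Proof.
move=> conn triT str; pose out x := [exists y, (y \notin T) && h x y].
have noout x y : ~~ out x -> h x y -> y \in T.
  by move=> /existsPn /(_ y) + hxy; rewrite hxy andbT negbK.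
have one a b c : T = [set a; b; c] -> h a b -> h a c -> h b c -> ~~ out a -> ~~ out b ->
    isomorphic h K3 \/ isomorphic h K4 \/ isomorphic h diamond \/ core T.
  move=> TE hab hac hbc oa ob.
  have Na y : h a y -> y \in [set a; b; c] by rewrite -TE; apply: noout.
  have Nb y : h b y -> y \in [set a; b; c] by rewrite -TE; apply: noout.
  by rewrite TE; case: (triangle_one_exit conn hab hac hbc Na Nb); auto.
have two a b c : T = [set a; b; c] -> h a b -> h a c -> h b c -> out b -> out c ->
    isomorphic h K3 \/ isomorphic h K4 \/ isomorphic h diamond \/ core T.
  move=> TE hab hac hbc /existsP [d /andP [dT hbd]] /existsP [d' /andP [d'T hcd']].
  have bT : b \in T by rewrite TE !inE eqxx orbT.
  have cT : c \in T by rewrite TE !inE eqxx orbT.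
  have E : d = d' by apply: (str b c) => //; apply: adj_neq.
  (* Any exit is compared with the one from [b], or with the one from [c] when it starts at [b]
     itself. *)
  have exit x y : x \in T -> y \notin T -> h x y -> y = d.
    move=> xT yT hxy; have [xb|xb] := eqVneq x b; last exact: (str x b).
    by rewrite E; apply: (str x c); rewrite // xb adj_neq.
  rewrite -E in hcd'; rewrite TE in dT exit *.
  by case: (triangle_two_exits conn hab hac hbc dT hbd hcd' exit); auto.
have [a [b [c [TE hab hac hbc]]]] := triangleP triT.
have Tbac : T = [set b; a; c] by rewrite TE (setUC [set a]).
have Tcab : T = [set c; a; b] by rewrite TE setUC setUA.
have Tacb : T = [set a; c; b] by rewrite TE setUAC.
have hba : h b a by rewrite hsym.
have hca : h c a by rewrite hsym.
have hcb : h c b by rewrite hsym.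
case: (boolP (out a)) => oa; case: (boolP (out b)) => ob.
- exact: (two c a b).
- by case: (boolP (out c)) => oc; [apply: (two b a c)|apply: (one b c a); rewrite // Tbac setUAC].
- by case: (boolP (out c)) => oc; [apply: (two a b c)|apply: (one a c b)].
- exact: (one a b c).
Qed.

(** The tips are not strong. If one middle vertex were in [U], the edge from [a] to the other would
    need a triangle in [TT], but the only triangle at [a] contains both middle vertices. So neither
    is in [U], and the triangles covering [ab] and [db] share the edge [bc]; they coincide and
    contain both non-adjacent tips. *)
Lemma diamond_no_decomposition U TT : isomorphic h diamond -> ~ decomposition U TT.
Proof.
case=> f [[g fK gK] hE] [strU indU strT uniqT cov].
have gE i j : h (g i) (g j) = diamond i j by rewrite hE !gK.
pose a := g (@Ordinal 4 0 isT); pose b := g (@Ordinal 4 1 isT).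
pose c := g (@Ordinal 4 2 isT); pose d := g (@Ordinal 4 3 isT).
have full x : [|| x == a, x == b, x == c | x == d].
  rewrite -(fK x) !(can_eq gK); by case: (f x) => [[|[|[|[|]]]]].
have [hab hac had] : [/\ h a b, h a c & ~~ h a d] by rewrite !gE.
have [hbc hbd hcd] : [/\ h b c, h b d & h c d] by rewrite !gE.
have hda : ~~ h d a by rewrite hsym.
have Na : h a =1 pred2 b c.
  move=> x; apply/idP/pred2P => [|[] -> //].
  by case/or4P: (full x) => /eqP ->; rewrite ?hirr ?(negPf had); auto.
have Nd : h d =1 pred2 b c.
  move=> x; apply/idP/pred2P => [|[] ->]; rewrite 1?hsym //.
  by case/or4P: (full x) => /eqP ->; rewrite ?hirr ?(negPf had); auto.
have notU x : h x =1 pred2 b c -> x \notin U.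
  by move=> Nx; apply/negP => /strU; apply: strong_center_pair Nx hbc.
have mid T x y : T \in TT -> x \in T -> y \in T -> h x y -> h x =1 pred2 b c ->
    (y == b) || (y == c) -> b \in T /\ c \in T.
  move=> TP xT yT hxy Nx yE; have [triT _ _] := strT T TP.
  have [z [TE _ hxz hyz]] := triangle_third triT xT yT (adj_neq hxy).
  move: hxz hyz yE; rewrite Nx TE => /pred2P zE + /pred2P yE.
  by case: zE => ->; case: yE => ->; rewrite ?hirr // !inE !eqxx !orbT.
have midU x y : h x =1 pred2 b c -> (y == b) || (y == c) -> b \notin U -> c \notin U ->
    exists T, [/\ T \in TT, x \in T, b \in T & c \in T].
  move=> Nx yE bU cU; have hxy : h x y by rewrite Nx.
  have [xU|yU|[T [TP xT yT]]] := cov x y hxy; first by move: (notU x Nx); rewrite xU.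
    by case/pred2P: yE yU => ->; [move/negP: bU|move/negP: cU].
  by have [] := mid T x y TP xT yT hxy Nx yE; exists T.
have bU : b \notin U.
  apply/negP => bU; have [aU|cU|[T [TP aT cT]]] := cov a c hac.
  - by move: (notU a Na); rewrite aU.
  - by move: (indU b c bU cU); rewrite hbc.
  have [|bT _] := mid T a c TP aT cT hac Na; first by rewrite eqxx orbT.
  by have [_ _ /disjointFl /(_ bU)] := strT T TP; rewrite bT.
have cU : c \notin U.
  apply/negP => cU; have [aU|bU'|[T [TP aT bT]]] := cov a b hab.
  - by move: (notU a Na); rewrite aU.
  - by move: bU; rewrite bU'.
  have [|_ cT] := mid T a b TP aT bT hab Na; first by rewrite eqxx.
  by have [_ _ /disjointFl /(_ cU)] := strT T TP; rewrite cT.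
have [|T [TP aT bT cT]] := midU a b Na _ bU cU; first by rewrite eqxx.
have [|T' [TP' dT' bT' cT']] := midU d b Nd _ bU cU; first by rewrite eqxx.
have TT' := uniqT T T' b c TP TP' bT bT' cT cT' (adj_neq hbc).
have [triT _ _] := strT T TP; have /andP [_ /cliqueP clT] := triT.
by move: had; rewrite clT // ?TT' // /a /d (can_eq gK).
Qed.

(** * From a decomposition to the bipartition of the reduction *)

Let F := pendant_reduction h.

Lemma R_triP r : reflect (exists a b, ptri h a b r) (r \in R_tri h).
Proof.
rewrite inE; apply: (iffP existsP) => [[a /existsP [b p]]|[a [b p]]]; first by exists a, b.
by exists a; apply/existsP; exists b.
Qed.

Lemma R_diamP r : reflect (exists a b c, pdiam h a b c r) (r \in R_diam h).
Proof.
rewrite inE; apply: (iffP existsP) => [[a /existsP [b /existsP [c p]]]|[a [b [c p]]]].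
  by exists a, b, c.
by exists a; apply/existsP; exists b; apply/existsP; exists c.
Qed.

Lemma R_K4P r : reflect (exists a b c, pK4 h a b c r) (r \in R_K4 h).
Proof.
rewrite inE; apply: (iffP existsP) => [[a /existsP [b /existsP [c p]]]|[a [b [c p]]]].
  by exists a, b, c.
by exists a; apply/existsP; exists b; apply/existsP; exists c.
Qed.

Lemma nonroots_reduction x : (x \in F) = (x \notin nonroots h).
Proof. by rewrite inE. Qed.

Lemma attached_notin x r : attached x r -> x \notin F.
Proof. by move=> xr; rewrite nonroots_reduction negbK; apply/nonrootsP; exists r. Qed.

(** The vertex set of the graph in condition (c). *)
Definition trimmed u := F :\: (nbhd_in h F u :&: R_tri h).

Lemma trimmed_self u : u \in F -> u \in trimmed u.
Proof. by move=> uF; rewrite !inE hirr andbF /= in uF *. Qed.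

Lemma attached_inv x r : attached x r ->
  [\/ exists b, ptri h x b r, exists b c, pdiam h x b c r,
     exists a c, pdiam h a x c r | exists b c, pK4 h x b c r].
Proof.
case=> a b c => [p|d p|d p|d p]; first by constructor 1; exists b.
- by constructor 2; exists b, c.
- by constructor 3; exists a, c.
- by constructor 4; exists b, c.
Qed.

Lemma strong_trimmed u : u \in F -> u \notin R_K4 h -> u \notin R_tri h ->
  strong_vertex_in h [set: V] u -> strong_vertex_in h (trimmed u) u.
Proof.
move=> uF uK4 utri str; apply: no_escape_strong => [|m [mP mI]]; first exact: trimmed_self.
(* Outside [trimmed u], the roots of pendant triangles are matched into their
   triangles and the pendant diamonds at [u] are matched internally. *)
pose Q w y := if w \in nonroots h then [exists a, pdiam h a w y u]
  else if w \in R_tri h then [exists b, ptri h y b w] else y == m w.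
pose m' w := odflt w [pick y | Q w y].
have uP r : attached u r -> False by move/attached_notin; rewrite uF.
have adjF x y r : attached x r -> y \in F -> h x y -> y = r.
  by move=> xr yF; apply: attached_adj_reduction.
have mQ w : h u w -> Q w (m' w).
  move=> huw; rewrite /m'; case: pickP => //= noQ.
  have hwu : h w u by rewrite hsym.
  case: (boolP (w \in nonroots h)) => [wN|wN].
    have [r wr] := (nonrootsP w).1 wN; have ur := adjF w u r wr uF hwu.
    rewrite -ur in wr; case: (attached_inv wr) => [[b p]|[b [c p]]|[a [c p]]|[b [c p]]].
    - by case/negP: utri; apply/R_triP; exists w, b.
    - by case/and5P: p => _ _ _ _ /and5P [_]; rewrite hwu.
    - by have := noQ c; rewrite /Q wN => /existsP []; exists a.
    - by case/negP: uK4; apply/R_K4P; exists w, b, c.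
  have := noQ (m w); rewrite /Q (negPf wN); case: ifP => [|_]; last by rewrite eqxx.
  case/R_triP => a [b p] _; have := noQ a; rewrite /Q (negPf wN).
  have -> : w \in R_tri h by apply/R_triP; exists a, b.
  by move=> /existsP []; exists b.
have cases w : h u w -> [\/ exists2 a, pdiam h a w (m' w) u & w \in nonroots h,
    exists2 b, ptri h (m' w) b w & w \in F |
    [/\ w \in trimmed u, w \in F & m' w = m w]].
  move=> huw; have := mQ w huw; rewrite /Q; case: ifP => [wN /existsP [a p]|wN].
    by constructor 1; exists a.
  have wF : w \in F by rewrite nonroots_reduction wN.
  case: ifP => [_ /existsP [b p]|wt /eqP E]; first by constructor 2; exists b.
  by constructor 3; split=> //; rewrite 3!inE wt andbF.
have triN a b w : ptri h a b w -> h u w -> ~~ h u a.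
  move=> p huw; apply/negP; rewrite hsym => /(adjF _ _ _ (attached_tri p) uF) E.
  by rewrite E hirr in huw.
have trimF w : w \in trimmed u -> w \in F by case/setDP.
have attF x r : attached x r -> x \in F -> False by move/attached_notin/negP.
apply: (@strong_no_escape [set: V] u m' str); split=> [w _ huw|w w' _ huw _ huw'].
  rewrite in_setT; case: (cases w huw) => [[a p _]|[b p _]|[wt _ ->]].
  - case/and5P: p => _ _ hwm _ /and5P [hmu _ _ _ _].
    by split; rewrite ?(adj_neq hmu).
  - have hw : h w (m' w) by case/and5P: p => _ _ hmw _ _; rewrite hsym.
    by split=> //; apply/negP => /eqP E; apply: (uP w); rewrite -E; apply: attached_tri p.
  - by have [_ ? ?] := mP w wt huw.
(* Partners of different kinds differ: one in a diamond is deleted and adjacent to [u], one in a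
   pendant triangle is deleted and not adjacent to [u], and [m w] lies in [trimmed u], which also
   keeps it apart from the triangle roots next to [u]. *)
case: (cases w huw) => [[a p wN]|[b p wF]|[wt wF mE]];
  case: (cases w' huw') => [[a' p' wN']|[b' p' wF']|[wt' wF' mE']].
- have [_ _ Nm] := pdiam_adj p; have [_ _ Nm'] := pdiam_adj p'.
  have nadj b c d : pdiam h b c d u -> ~~ h u b.
    by case/and5P=> _ _ _ _ /and5P [_ + _ _ _]; rewrite hsym.
  split=> E; first have : h (m' w) w' by rewrite E Nm' /= eqxx orbT.
    rewrite Nm => /or3P [] /eqP // w'E; first by rewrite w'E (negPf (nadj _ _ _ p)) in huw'.
    by rewrite w'E hirr in huw'.
  have : h w' (m' w') by case/and5P: p' => _ _ ? _ _.
  rewrite -{1}E Nm => /or3P [] /eqP // mE.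
    by case/and5P: p' => _ _ _ _ /and5P [h1 _ _ _ _]; move: (nadj _ _ _ p); rewrite -mE hsym h1.
  by case/and5P: p' => _ _ _ _ /and5P [h1 _ _ _ _]; rewrite mE hirr in h1.
- have hmu : h u (m' w) by case/and5P: p => _ _ _ _ /and5P [h1 _ _ _ _]; rewrite hsym.
  split=> E; first by rewrite E (negPf (triN _ _ _ p' huw')) in hmu.
  by case: (attF _ _ (attached_mid (pdiam_sym p))); rewrite E.
- split=> E; case: (attF _ _ (attached_mid (pdiam_sym p))); last by rewrite E.
  by rewrite E mE'; apply: trimF; have [] := mP w' wt' huw'.
- have hmu : h u (m' w') by case/and5P: p' => _ _ _ _ /and5P [h1 _ _ _ _]; rewrite hsym.
  split=> E; first by rewrite -E (negPf (triN _ _ _ p huw)) in hmu.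
  by rewrite -E (negPf (triN _ _ _ p huw)) in huw'.
- split=> E; last by rewrite -E (negPf (triN _ _ _ p huw)) in huw'.
  apply/esym; apply: adjF (attached_tri p) wF' _.
  by rewrite E; case/and5P: p' => _ _ ? _ _.
- split=> E; last by rewrite -E (negPf (triN _ _ _ p huw)) in huw'.
  case: (attF _ _ (attached_tri p)).
  by rewrite E mE'; apply: trimF; have [] := mP w' wt' huw'.
- have mF : m' w \in F by rewrite mE; apply: trimF; have [] := mP w wt huw.
  split=> E; first by case: (attF _ _ (attached_mid (pdiam_sym p'))); rewrite -E.
  by rewrite -E nonroots_reduction in wN' mF; rewrite wN' in mF.
- have mF : m' w \in F by rewrite mE; apply: trimF; have [] := mP w wt huw.
  split=> E; first by case: (attF _ _ (attached_tri p')); rewrite -E.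
  have [mt _ _] := mP w wt huw; case/setDP: mt => _; rewrite -mE E => /negP []; apply/setIP.
  by split; [rewrite inE huw' wF'|apply/R_triP; exists (m' w'), b'].
- by rewrite mE mE'; apply: mI.
Qed.

Lemma decomposition_bipartition U TT : decomposition U TT ->
  (forall T, T \in TT -> core T) ->
  [/\ bipartition h F (U :&: F) (F :\: U), R_diam h :|: R_K4 h \subset U :&: F,
      R_tri h \subset F :\: U &
      forall u, u \in (U :&: F) :\: R_K4 h -> strong_vertex_in h (trimmed u) u].
Proof.
move=> [strU indU strT uniqT cov] coreT.
have notU x r : attached x r -> x \notin U.
  by move=> xr; apply/negP => /strU; apply: attached_not_strong xr.
(* The edge [ab] has no end in [U], and the only triangle that can cover it contains [c]; members of
   [TT] avoid [U]. *)
have triW : R_tri h \subset F :\: U.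
  apply/subsetP => c /R_triP [a [b p]]; have cF := root_reduction (attached_tri p).
  rewrite inE cF andbT; have [Na Nb] := ptri_adj p.
  have hab : h a b by rewrite Na /= eqxx.
  have [aU|bU|[T [TP aT bT]]] := cov a b hab.
  - by case/negP: (notU _ _ (attached_tri p)).
  - by case/negP: (notU _ _ (attached_tri (ptri_sym p))).
  have [triT _ disT] := strT T TP.
  have [z [TE _ haz hbz]] := triangle_third triT aT bT (adj_neq hab).
  have zc : z = c.
    by move: haz; rewrite Na => /pred2P [zb|//]; rewrite zb hirr in hbz.
  by rewrite (disjointFr disT) // TE -zc !inE eqxx orbT.
(* With [d] outside [U], the edges [ab] and [bd] would be covered by the triangles [abc] and [bcd],
   which share the edge [bc]. *)
have diamU : R_diam h \subset U :&: F.
  apply/subsetP => d /R_diamP [a [b [c p]]]; have dF := root_reduction (attached_tip p).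
  rewrite inE dF andbT; have [Na Nb Nc] := pdiam_adj p.
  have aU := notU _ _ (attached_tip p); have bU := notU _ _ (attached_mid p).
  have [hab hbd had ad] : [/\ h a b, h b d, ~~ h a d & a != d].
    by case/and5P: p => -> _ _ -> /and5P [_ -> -> _ _].
  have [bU'|//|[T' [TP' bT' dT']]] := cov b d hbd; first by rewrite bU' in bU.
  have [aU'|bU'|[T [TP aT bT]]] := cov a b hab; [by rewrite aU' in aU|by rewrite bU' in bU|].
  have [triT _ _] := strT T TP; have [triT' _ _] := strT T' TP'.
  have [z [TE _ haz hbz]] := triangle_third triT aT bT (adj_neq hab).
  have [z' [TE' _ hbz' hdz']] := triangle_third triT' bT' dT' (adj_neq hbd).
  have zc : z = c by move: haz; rewrite Na => /pred2P [zb|//]; rewrite zb hirr in hbz.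
  have zc' : z' = c.
    move: hbz'; rewrite Nb => /or3P [] /eqP // zE; first by rewrite zE hsym (negPf had) in hdz'.
    by rewrite zE hirr in hdz'.
  have cT : c \in T by rewrite TE zc !inE eqxx !orbT.
  have cT' : c \in T' by rewrite TE' zc' !inE eqxx !orbT.
  have bc : b != c by apply: adj_neq; rewrite Nb /= eqxx orbT.
  move: dT'; rewrite -(uniqT T T' b c) // TE zc !inE !(eq_sym d) (negPf ad).
  rewrite (negPf (adj_neq hbd)) /= => /eqP cd; move: hdz'; by rewrite zc' cd hirr.
(* With [d] outside [U], a triangle in [TT] would cover [ad]. It would have disjoint exits: from [d]
   to a vertex [d'] outside the [K_4], and from [a] to the one of [b], [c] left over. *)
have K4U : R_K4 h \subset U :&: F.
  apply/subsetP => d /R_K4P [a [b [c p]]]; have dF := root_reduction (attached_K4 p).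
  rewrite inE dF andbT; have [Na Nb Nc] := pK4_adj p; have [_ _ _ dd] := pK4_deg p.
  have aU := notU _ _ (attached_K4 p).
  have had : h a d by rewrite Na /= eqxx !orbT.
  have [aU'|//|[T [TP aT dT]]] := cov a d had; first by rewrite aU' in aU.
  have [triT exT _] := strT T TP.
  have [z [TE _ haz hdz]] := triangle_third triT aT dT (adj_neq had).
  have [|d' hdd'] := @deg_gt_exit [set a; b; c] d.
    by apply: leq_trans dd; rewrite setUC cardsU1 cards2; case: (c \notin _); case: (_ != _).
  rewrite !inE !negb_or => /andP [/andP [d'a d'b] d'c].
  have [w [haw wT wd']] : exists w, [/\ h a w, w \notin T & w != d'].
    have [hab hac hbc hbd hcd] : [/\ h a b, h a c, h b c, h b d & h c d].
      by case/and5P: p => -> -> _ -> /and5P [-> -> _ _ _].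
    have [zb|zc] : z = b \/ z = c.
      by move: haz; rewrite Na => /or3P [] /eqP E; auto; rewrite E hirr in hdz.
      exists c; rewrite TE zb !inE !(eq_sym c) (negPf (adj_neq hac)) (negPf (adj_neq hbc)).
      by rewrite (eq_sym d) (negPf (adj_neq hcd)).
    exists b; rewrite TE zc !inE !(eq_sym b) (negPf (adj_neq hab)) (eq_sym c).
    by rewrite (negPf (adj_neq hbc)) (eq_sym d) (negPf (adj_neq hbd)).
  case/eqP: wd'; apply: (exT a d) => //; first exact: adj_neq.
  rewrite TE !inE !negb_or d'a eq_sym (adj_neq hdd') /=.
  by move: haz; rewrite Na => /or3P [] /eqP E; rewrite E // hirr in hdz *.
have UV x y : x \in F -> y \in F -> h x y -> x \in U \/ y \in U.
  move=> xF yF hxy; have [xU|yU|[T [TP xT yT]]] := cov x y hxy; auto.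
  have := core_attached (coreT T TP) xT yT (adj_neq hxy).
  by move: xF yF; rewrite !nonroots_reduction => /negP + /negP + [].
split=> //; last 2 first.
- by rewrite subUset diamU.
- move=> u; rewrite in_setD in_setI => /and3P [uK4 uU uF].
  apply: strong_trimmed => //; last exact: strU.
  by apply/negP => /(subsetP triW); rewrite in_setD uU.
apply/and4P; split.
- by rewrite setIC setID.
- by apply/eqP/setP => x; rewrite !inE; case: (x \in U); rewrite ?andbF.
- by apply/independentP => x y /setIP [xU _] /setIP [yU _]; apply: indU.
apply/independentP => x y /setDP [xF xU] /setDP [yF yU]; apply/negP => hxy.
by case: (UV x y xF yF hxy) => E; rewrite E in xU yU.
Qed.

(** * From the bipartition back to a decomposition *)

Lemma strong_untrimmed U W u : bipartition h F U W -> R_diam h :|: R_K4 h \subset U ->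
  R_tri h \subset W -> u \in U -> strong_vertex_in h (trimmed u) u ->
  strong_vertex_in h [set: V] u.
Proof.
move=> /and4P [/eqP UW /eqP UW0 /independentP indU /independentP indW] dkU tW uU str.
apply: no_escape_strong => // m [mP mI].
have notUW x : x \in U -> x \in W -> False by move=> xU xW; have := in_set0 x; rewrite -UW0 inE xU xW.
have WF x : x \in W -> x \in F by move=> xW; rewrite -UW inE xW orbT.
have sideW x y : x \in U -> y \in F -> h x y -> y \in W.
  by move=> xU yF hxy; move: yF hxy; rewrite -UW => /setUP [/(indU x y xU) /negPf ->|].
(* The restriction of [m] stays inside [trimmed u]: a neighbour [w] of [u] there lies in [W] and is
   not a triangle root, hence not a root at all, so [m w] is in the reduction, and in [U], where
   nothing is trimmed. *)
apply: (strong_no_escape str (m := m)); split=> [w wt huw|w w' _ huw _ huw'].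
  have [_ mu hwm] := mP w (in_setT _) huw; split=> //.
  have [wF wN] := setDP wt; have wW := sideW u w uU wF huw.
  have wtri : w \notin R_tri h.
    by apply: contraNN wN => wtri; rewrite in_setI wtri andbT inE wF huw.
  have mF : m w \in F.
    rewrite nonroots_reduction; apply/negP => /nonrootsP [r mr].
    have wr : w = r by apply: attached_adj_reduction mr wF _; rewrite hsym.
    case: (notUW w) => //; apply: (subsetP dkU); rewrite -{}wr in mr.
    case: (attached_inv mr) => [[b p]|[b [c p]]|[a [c p]]|[b [c p]]]; rewrite in_setU.
    - by case/negP: wtri; apply/R_triP; exists (m w), b.
    - by apply/orP; left; apply/R_diamP; exists (m w), b, c.
    - by apply/orP; left; apply/R_diamP; exists a, (m w), c.
    - by apply/orP; right; apply/R_K4P; exists (m w), b, c.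
  rewrite in_setD mF andbT in_setI negb_and; apply/orP; right.
  by apply/negP => /(subsetP tW) mW; have := indW w (m w) wW mW; rewrite hwm.
exact: mI.
Qed.

(** Recovers a core from any of its non-root vertices, since among the roots concerned exactly those
    outside their core are in [U]. Cores that share a non-root vertex therefore coincide. *)
Lemma core_neighbourhood U T x : R_diam h :|: R_K4 h \subset U -> [disjoint R_tri h & U] ->
  U \subset F -> core T -> x \in T -> x \in nonroots h ->
  T = x |: ([set y | h x y] :\: U).
Proof.
move=> dkU tU UF cT.
have dU d : d \in R_diam h -> d \in U by move=> dR; apply: (subsetP dkU); rewrite in_setU dR.
have kU d : d \in R_K4 h -> d \in U by move=> dR; apply: (subsetP dkU); rewrite in_setU dR orbT.
have att y r : attached y r -> y \notin U.
  by move/attached_notin; apply: contraNN; apply: (subsetP UF).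
case: cT => a b c => [p|d p|d p]; rewrite !in_setU !in_set1 -orbA => xT xN.
- have [Na Nb] := ptri_adj p; have cR : c \in R_tri h by apply/R_triP; exists a, b.
  have aU := att _ _ (attached_tri p); have bU := att _ _ (attached_tri (ptri_sym p)).
  have cU : c \notin U by rewrite (disjointFr tU cR).
  have cN : c \notin nonroots h by rewrite -nonroots_reduction (root_reduction (attached_tri p)).
  case/or3P: xT xN => /eqP ->; rewrite ?(negPf cN) // => _; apply/setP => z;
    rewrite !in_setU !in_setD !in_set1 in_set ?Na ?Nb /=;
    case: (eqVneq z a) => [->|_]; rewrite ?aU ?orbT //;
    case: (eqVneq z b) => [->|_]; rewrite ?bU ?orbT //;
    by case: (eqVneq z c) => [->|_]; rewrite ?cU /= ?andbF.
- have [Na Nb Nc] := pdiam_adj p.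
  have dR : d \in U by apply/dU/R_diamP; exists a, b, c.
  have aU := att _ _ (attached_tip p); have bU := att _ _ (attached_mid p).
  have cU := att _ _ (attached_mid (pdiam_sym p)).
  case/or3P: xT => /eqP ->; apply/setP => z;
    rewrite !in_setU !in_setD !in_set1 in_set ?Na ?Nb ?Nc /=;
    case: (eqVneq z a) => [->|_]; rewrite ?aU ?orbT //;
    case: (eqVneq z b) => [->|_]; rewrite ?bU ?orbT //;
    case: (eqVneq z c) => [->|_]; rewrite ?cU ?orbT /= ?andbF //;
    by case: (eqVneq z d) => [->|_]; rewrite ?dR /= ?andbF.
have [Na Nb Nc] := pK4_adj p.
have dR : d \in U by apply/kU/R_K4P; exists a, b, c.
have aU := att _ _ (attached_K4 p); have bU := att _ _ (attached_K4 (pK4_sym p)).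
have cU := att _ _ (attached_K4 (pK4_rot p)).
case/or3P: xT => /eqP ->; apply/setP => z;
  rewrite !in_setU !in_setD !in_set1 in_set ?Na ?Nb ?Nc /=;
  case: (eqVneq z a) => [->|_]; rewrite ?aU ?orbT //;
  case: (eqVneq z b) => [->|_]; rewrite ?bU ?orbT //;
  case: (eqVneq z c) => [->|_]; rewrite ?cU ?orbT //;
  by case: (eqVneq z d) => [->|_]; rewrite ?dR /= ?andbF.
Qed.

Lemma bipartition_decomposition U W : bipartition h F U W ->
  R_diam h :|: R_K4 h \subset U -> R_tri h \subset W ->
  (forall u, u \in U :\: R_K4 h -> strong_vertex_in h (trimmed u) u) ->
  decomposition U [set x |: ([set y | h x y] :\: U) | x in nonroots h].
Proof.
move=> bip dkU tW strU; have /and4P [/eqP UW /eqP UW0 /independentP indU /independentP indW] := bip.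
have UF : U \subset F by rewrite -UW subsetUl.
have tU : [disjoint R_tri h & U].
  apply/pred0Pn => -[x /andP [/= /(subsetP tW) xW xU]].
  by have := in_set0 x; rewrite -UW0 inE xU xW.
have coreE T x := core_neighbourhood (T := T) (x := x) dkU tU UF.
have notU x : x \in nonroots h -> x \notin U.
  by move=> xN; apply/negP => /(subsetP UF); rewrite nonroots_reduction xN.
have blockP x : x \in nonroots h -> exists T, [/\ core T, x \in T & T = x |: ([set y | h x y] :\: U)].
  move=> xN; have [r xr] := (nonrootsP x).1 xN; have [T cT xT] := attached_core xr.
  by exists T; split=> //; apply: coreE.
have coreP T : T \in [set x |: ([set y | h x y] :\: U) | x in nonroots h] ->
    core T /\ [disjoint T & U].
  case/imsetP => x xN ->; have [T' [cT xT E]] := blockP x xN; rewrite -{1}E; split=> //.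
  apply/pred0Pn => -[y /andP [/= + yU]]; rewrite in_setU1 in_setD yU orbF => /eqP yx.
  by move: yU; rewrite yx (negPf (notU x xN)).
split=> [u uU|x y xU yU|T TP|T T' x y TP TP' xT xT' yT yT' xy|x y hxy].
- case: (boolP (u \in R_K4 h)) => [/R_K4P [a [b [c p]]]|uK4]; first exact: pK4_root_strong p.
  by apply: (strong_untrimmed bip dkU tW uU); apply: strU; rewrite in_setD uK4.
- exact: indU.
- by have [cT dT] := coreP T TP; split=> //; [apply: core_triangle|apply: core_no_disjoint_exits].
- have [cT _] := coreP T TP; have [cT' _] := coreP T' TP'.
  (* One of the two common vertices is a non-root vertex, which determines the core. *)
  have [zN|zN] := core_attached cT xT yT xy.
    by rewrite (coreE T x cT xT zN) (coreE T' x cT' xT' zN).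
  by rewrite (coreE T y cT yT zN) (coreE T' y cT' yT' zN).
have block u v : u \in nonroots h -> h u v -> v \notin U ->
    exists T, [/\ T \in [set x |: ([set y | h x y] :\: U) | x in nonroots h], u \in T & v \in T].
  move=> uN huv vU; exists (u |: ([set y | h u y] :\: U)); split; first by apply/imsetP; exists u.
    exact: setU11.
  by rewrite in_setU1 in_setD vU inE huv orbT.
(* An edge without an end in [U] cannot join two vertices of the independent set [W], so it has a
   non-root end. *)
case: (boolP (x \in U)) => [|xU]; first by constructor 1.
case: (boolP (y \in U)) => [|yU]; first by constructor 2.
constructor 3; case: (boolP (x \in nonroots h)) => [xN|xN]; first exact: block.
case: (boolP (y \in nonroots h)) => [yN|yN].
  by have [|T [TP yT xT]] := block y x yN _ xU; rewrite 1?hsym //; exists T.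
move: xN yN; rewrite -!nonroots_reduction -UW !in_setU (negPf xU) (negPf yU) => xW yW.
by have := indW x y xW yW; rewrite hxy.
Qed.

(** * The exceptional graphs [K3] and [K4] *)

Lemma K3_localizable : isomorphic h K3 -> localizable (line_graph h).
Proof.
case=> f [bijf hE]; have hne x y : h x y = (x != y) by rewrite hE /K3 (bij_eq bijf).
apply: (@decomposition_localizable set0 [set [set: V]]); split=> [u|x y|T|T T' x y|x y _].
- by rewrite inE.
- by rewrite inE.
- move/set1P => ->; split; last by rewrite disjoint_sym disjoints_subset sub0set.
    apply/andP; split; first by rewrite cardsT (bij_eq_card bijf) card_ord.
    by apply/cliqueP => x y _ _; rewrite hne.
  by move=> x y x' y' _ _ _; rewrite inE.
- by move=> /set1P -> /set1P ->.
- by constructor 3; exists [set: V]; rewrite set11 !in_setT.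
Qed.

(** One star and the opposite triangle suffice: the centre [v] is strong because its three
    neighbours cannot be paired up among themselves, and all exits of the triangle end at [v]. *)
Lemma K4_localizable : isomorphic h K4 -> localizable (line_graph h).
Proof.
case=> f [bijf hE]; have hne x y : h x y = (x != y) by rewrite hE /K4 (bij_eq bijf).
have [g _ _] := bijf; pose v := g ord0.
have T3 : #|[set~ v]| = 3 by rewrite cardsC1 (bij_eq_card bijf) card_ord.
have triT : triangle [set~ v].
  by apply/andP; rewrite T3; split=> //; apply/cliqueP => x y _ _; rewrite hne.
apply: (@decomposition_localizable [set v] [set [set~ v]]).
split=> [u /set1P ->|x y|T|T T' x y|x y hxy].
- have [a [b [c [TE hab hac hbc]]]] := triangleP triT.
  have full x : [|| x == a, x == b, x == c | x == v].
    by have /setP /(_ x) := TE; rewrite !inE; case: (x == v) => /= E; rewrite ?orbT // orbF orbA -E.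
  have vT x : x \in [set a; b; c] -> h v x by rewrite -TE !inE eq_sym hne.
  apply: no_escape_strong => // m.
  have [va vb vc] : [/\ h v a, h v b & h v c] by rewrite !vT // !inE eqxx ?orbT.
  apply: (no_escape_K4 (a := a) (b := b) (c := c)) => // x; rewrite hne /=.
  + apply/idP/idP => [ax|]; first by have := full x; rewrite eq_sym (negPf ax).
    by case/or3P => /eqP ->; rewrite ?adj_neq // hsym.
  + apply/idP/idP => [bx|]; first by have := full x; rewrite orbCA eq_sym (negPf bx).
    by case/or3P => /eqP ->; rewrite ?adj_neq // hsym.
  + apply/idP/idP => [cx|]; first by have := full x; rewrite (eq_sym x c) (negPf cx).
    by case/or3P => /eqP ->; rewrite ?adj_neq // hsym.
- by move=> /set1P -> /set1P ->; rewrite hirr.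
- move/set1P => ->; split=> //; last by rewrite disjoint_sym disjoints_subset sub1set !inE negbK.
  by move=> x y x' y' _ _ _; rewrite !inE !negbK => /eqP -> /eqP ->.
- by move=> /set1P -> /set1P ->.
case: (eqVneq x v) => [->|xv]; first by constructor 1; rewrite set11.
case: (eqVneq y v) => [->|yv]; first by constructor 2; rewrite set11.
by constructor 3; exists [set~ v]; rewrite set11 !inE.
Qed.

End Matchings.

Theorem mainTheorem17 (V : finType) (h : rel V)
  (hsym : symmetric h) (hirr : irreflexive h)
  (hconn : connected_on h [set: V]) :
  localizable (line_graph h) <->
  ((~ isomorphic h K3 /\ ~ isomorphic h K4 /\ ~ isomorphic h diamond) /\
     connected_on h (pendant_reduction h) /\
     exists U W : {set V},
       [/\ bipartition h (pendant_reduction h) U W,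
           R_diam h :|: R_K4 h \subset U,
           R_tri h \subset W &
           forall u, u \in U :\: R_K4 h ->
             strong_vertex_in h
               (pendant_reduction h :\: (nbhd_in h (pendant_reduction h) u :&: R_tri h)) u])
  \/ (isomorphic h K3 \/ isomorphic h K4).
Proof.
split=> [loc|[[_ [_ [U [W [bip dkU tW str]]]]]|[isoK3|isoK4]]].
(* [K3] and [K4] are set aside first, because their triangles are not cores. *)
- have [isoK3|nK3] := isomorphic_decidable h K3; first by right; left.
  have [isoK4|nK4] := isomorphic_decidable h K4; first by right; right.
  left; have [U [TT dec]] := localizable_decomposition hsym hirr loc.
  have nD : ~ isomorphic h diamond.
    by move=> isoD; apply: diamond_no_decomposition isoD dec.
  have coreT T : T \in TT -> core h T.
    case: dec => _ _ strT _ _ /strT [triT exT _].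
    by have [|[|[|]]] := strong_triangle_cases hsym hirr hconn triT exT.
  have [bip dkU tW str] := decomposition_bipartition hsym hirr dec coreT.
  split=> //; split; first exact: reduction_connected.
  by exists (U :&: pendant_reduction h), (pendant_reduction h :\: U).
- exact: decomposition_localizable (bipartition_decomposition hsym hirr bip dkU tW str).
- exact: K3_localizable.
- exact: K4_localizable.
Qed.
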